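(* (Cascade.) The set of triples in the rate region of the function computation problem with $R_X=0$ equals $\{(R_0,0,R_Y): R_0\ge H(G_{X|Y}),\ R_Y\ge H(f(X,Y))\}$.
   Context: Setup: $\mathcal X,\mathcal Y,\mathcal F$ finite, $(X_i,Y_i)_{i\ge1}$ i.i.d. copies of $(X,Y)\sim p(x,y)$, $f:\mathcal X\times\mathcal Y\to\mathcal F$ applied componentwise to sequences. An $(n,R_0,R_X,R_Y)$ code consists of encoders $\varphi_0:\mathcal X^n\to\{1,\dots,2^{nR_0}\}$, $\varphi_X:\mathcal X^n\to\{1,\dots,2^{nR_X}\}$, $\varphi_Y:\mathcal Y^n\times\{1,\dots,2^{nR_0}\}\to\{1,\dots,2^{nR_Y}\}$ and a decoder $\psi:\{1,\dots,2^{nR_X}\}\times\{1,\dots,2^{nR_Y}\}\to\mathcal F^n$, with error probability $P(\psi(\varphi_X(\mathbf X),\varphi_Y(\varphi_0(\mathbf X),\mathbf Y))\ne f(\mathbf X,\mathbf Y))$. A triple is achievable if for every $\varepsilon>0$ and all large $n$ a code with error probability $\le\varepsilon$ exists; the rate region is the closure of the achievable set. $G_{X|Y}$ is the graph with vertex set $\mathcal X$ in which $x_1,x_2$ are adjacent iff there is $y$ with $p(x_1,y)p(x_2,y)>0$ and $f(x_1,y)\ne f(x_2,y)$. The conditional graph entropy is $H(G_{X|Y})=\min I(V;X|Y)$ over random variables $V$ with $V-X-Y$ Markov, each value of $V$ an independent set of $G_{X|Y}$, and $P(X\in V)=1$. *)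

(* Defs.v *)
From mathcomp Require Import ssreflect ssrfun ssrbool eqtype ssrnat seq choice.
From mathcomp Require Import fintype finfun bigop finset.
From Stdlib Require Import Reals ZArith Classical ClassicalEpsilon.

Set Implicit Arguments.
Unset Strict Implicit.
Unset Printing Implicit Defensive.

Local Open Scope R_scope.

Definition rsum (T : finType) (g : T -> R) : R := \big[Rplus/0]_(t : T) g t.

Definition log2 (x : R) : R := ln x / ln 2.

Definition plogp (q : R) : R := if Rlt_dec 0 q then q * log2 q else 0.

(* infimum of a set of reals (0 if it has no greatest lower bound) *)
Definition is_glb (E : R -> Prop) (m : R) : Prop :=
  (forall x, E x -> m <= x) /\ (forall m', (forall x, E x -> m' <= x) -> m' <= m).

Definition Rinf (E : R -> Prop) : R :=
  match excluded_middle_informative (exists m, is_glb E m) with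
  | left H => proj1_sig (constructive_indefinite_description _ H)
  | right _ => 0
  end.

Definition is_pmf (X Y : finType) (p : X -> Y -> R) : Prop :=
  (forall x y, 0 <= p x y) /\ rsum (fun x => rsum (fun y => p x y)) = 1.

Section Defs.
Variables (X Y F : finType) (p : X -> Y -> R) (f : X -> Y -> F).

Definition pf (z : F) : R := rsum (fun x => rsum (fun y => if f x y == z then p x y else 0)).
Definition entropy_f : R := - rsum (fun z => plogp (pf z)).

Definition adjG (x1 x2 : X) : Prop :=
  exists y, 0 < p x1 y * p x2 y /\ f x1 y <> f x2 y.

Definition indep_set (S : {set X}) : Prop :=
  forall x1 x2, x1 \in S -> x2 \in S -> ~ adjG x1 x2.

(* V is given by a channel w v x = P(V = v | X = x), V taking values in
   subsets of X; the joint law is p(x,y) w(v|x), so V - X - Y is Markov. *)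
Definition pX (x : X) : R := rsum (fun y => p x y).
Definition pY (y : Y) : R := rsum (fun x => p x y).

Definition admissible_V (w : {set X} -> X -> R) : Prop :=
  (forall v x, 0 <= w v x) /\
  (forall x, rsum (fun v => w v x) = 1) /\
  (* every value of V (with positive probability) is an independent set,
     and P(X \in V) = 1 *)
  (forall v x, 0 < pX x * w v x -> indep_set v /\ x \in v).

Definition pVY (w : {set X} -> X -> R) (v : {set X}) (y : Y) : R :=
  rsum (fun x => p x y * w v x).

Definition cond_MI (w : {set X} -> X -> R) : R :=
  rsum (fun v => rsum (fun x => rsum (fun y =>
    let q := p x y * w v x in
    if Rlt_dec 0 q then q * log2 (q * pY y / (pVY w v y * p x y)) else 0))).

Definition cond_graph_entropy : R :=
  Rinf (fun r => exists w, admissible_V w /\ r = cond_MI w).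

(* number of messages for rate r at blocklength n : floor (2^{n r}) *)
Definition msgs (n : nat) (r : R) : nat :=
  Z.to_nat (up (Rpower 2 (INR n * r)) - 1).

Definition Pn (n : nat) (xs : {ffun 'I_n -> X}) (ys : {ffun 'I_n -> Y}) : R :=
  \big[Rmult/1]_(i < n) p (xs i) (ys i).

Definition fseq (n : nat) (xs : {ffun 'I_n -> X}) (ys : {ffun 'I_n -> Y})
  : {ffun 'I_n -> F} := [ffun i => f (xs i) (ys i)].

Definition err_prob (n : nat) (M0 MX MY : nat)
  (phi0 : {ffun 'I_n -> X} -> 'I_M0) (phiX : {ffun 'I_n -> X} -> 'I_MX)
  (phiY : {ffun 'I_n -> Y} -> 'I_M0 -> 'I_MY)
  (psi : 'I_MX -> 'I_MY -> {ffun 'I_n -> F}) : R :=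
  rsum (fun xs => rsum (fun ys =>
    if psi (phiX xs) (phiY ys (phi0 xs)) != fseq xs ys then Pn xs ys else 0)).

Definition achievable (R0 RX RY : R) : Prop :=
  forall eps, 0 < eps -> exists N : nat, forall n : nat, (N <= n)%nat ->
    exists (phi0 : {ffun 'I_n -> X} -> 'I_(msgs n R0))
           (phiX : {ffun 'I_n -> X} -> 'I_(msgs n RX))
           (phiY : {ffun 'I_n -> Y} -> 'I_(msgs n R0) -> 'I_(msgs n RY))
           (psi : 'I_(msgs n RX) -> 'I_(msgs n RY) -> {ffun 'I_n -> F}),
      err_prob phi0 phiX phiY psi <= eps.

Definition in_rate_region (R0 RX RY : R) : Prop :=
  forall d, 0 < d -> exists a b c, achievable a b c /\
    Rabs (a - R0) < d /\ Rabs (b - RX) < d /\ Rabs (c - RY) < d.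

End Defs.

(* Main.v *)
Require Import Defs.
From HB Require Import structures.
From mathcomp Require Import ssreflect ssrfun ssrbool eqtype ssrnat seq choice.
From mathcomp Require Import fintype finfun bigop finset.
From Stdlib Require Import Reals Lra Lia ZArith Classical ClassicalEpsilon.

(** Achievability.  Fix an admissible channel [w] and draw a codebook of [M * K] words
    i.i.d. from the law of [V^n].  The encoder picks a codeword with probability
    proportional to [w (v | x)] and transmits only its row; the second node picks a
    codeword of that row proportionally to the likelihood of [y].  Convexity of
    [1 / (a b)] bounds the mean probability that both picks agree, without typical sets,
    and Chernoff's bound makes the error vanish when [ln M > n I(V; X | Y)].  A word [v]
    with [w (v | x) > 0] determines [f x y] letter by letter, and [f x y] is then
    compressed to its entropy.

    Converse.  For the second rate, a set of [e^(n a)] words with [a < H(f)] has vanishing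
    probability.  For the first one, let [A_i] be the set of the letters [x] for which the
    decoder, given the message and [Y_j] for [j <> i], would be right at place [i] for
    every [Y_i] compatible with [x]; [A_i] is independent in the graph.  Put [V_i = A_i]
    if [X_i] is in [A_i], and [V_i = {X_i}] otherwise.  Then [V_i - X_i - Y_i] is Markov,
    [V_i] is almost determined by the message and [Y^n], and Gibbs' inequality bounds the
    sum of the [I(V_i; X_i | Y_i)] by the log of the number of messages plus [o(n)]. *)

Set Implicit Arguments.
Unset Strict Implicit.
Unset Printing Implicit Defensive.

Local Open Scope R_scope.

(** * Finite sums and products of reals *)

Lemma RplusA : associative Rplus.
Proof. by move=> x y z; rewrite Rplus_assoc. Qed.

Lemma RmultA : associative Rmult.
Proof. by move=> x y z; rewrite Rmult_assoc. Qed.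

HB.instance Definition _ := Monoid.isComLaw.Build R 0 Rplus RplusA Rplus_comm Rplus_0_l.
HB.instance Definition _ := Monoid.isComLaw.Build R 1 Rmult RmultA Rmult_comm Rmult_1_l.
HB.instance Definition _ := Monoid.isMulLaw.Build R 0 Rmult Rmult_0_l Rmult_0_r.
HB.instance Definition _ := Monoid.isAddLaw.Build R Rmult Rplus
  Rmult_plus_distr_r Rmult_plus_distr_l.

Definition rprod (T : finType) (g : T -> R) : R := \big[Rmult/1]_(t : T) g t.

Local Notation "\sum_ i F" := (rsum (fun i => F)) : R_scope.
Local Notation "\sum_ ( i : T ) F" := (rsum (fun i : T => F)) : R_scope.
Local Notation "\prod_ i F" := (rprod (fun i => F)) : R_scope.
Local Notation "\prod_ ( i : T ) F" := (rprod (fun i : T => F)) : R_scope.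

Definition indic (b : bool) : R := if b then 1 else 0.

Lemma indic_ge0 (b : bool) : 0 <= indic b.
Proof. by case: b => /=; lra. Qed.

Lemma indic_le1 (b : bool) : indic b <= 1.
Proof. by case: b => /=; lra. Qed.

Lemma indicN (b : bool) : indic (~~ b) = 1 - indic b.
Proof. by case: b => /=; lra. Qed.

Definition Rltb (x y : R) : bool := if Rlt_dec x y then true else false.

Lemma RltbP (x y : R) : reflect (x < y) (Rltb x y).
Proof. by rewrite /Rltb; case: Rlt_dec => ?; constructor. Qed.

Lemma Rdiv_ge0 (x y : R) : 0 <= x -> 0 <= y -> 0 <= x / y.
Proof.
move=> x0 [y0|<-]; last by rewrite /Rdiv Rinv_0; lra.
exact: Rle_mult_inv_pos.
Qed.

Lemma Rmult_gt0_inv (x y : R) : 0 <= x -> 0 <= y -> 0 < x * y -> 0 < x /\ 0 < y.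
Proof. by move=> x0 y0 xy; nra. Qed.

Section RealSums.
Variable T : finType.
Implicit Types (g h : T -> R) (a : R).

Lemma eq_rsum g h : (forall t, g t = h t) -> \sum_t g t = \sum_t h t.
Proof. by move=> gh; apply: eq_bigr => t _. Qed.

Lemma rsum_le g h : (forall t, g t <= h t) -> \sum_t g t <= \sum_t h t.
Proof.
by move=> gh; apply: (big_ind2 Rle) => [|a b c d ab cd|t _]; [lra|lra|exact: gh].
Qed.

Lemma rsum_ge0 g : (forall t, 0 <= g t) -> 0 <= \sum_t g t.
Proof. by move=> g0; apply: big_ind => [|a b|t _]; [lra|lra|exact: g0]. Qed.

Lemma rsumD g h : \sum_t (g t + h t) = \sum_t g t + \sum_t h t.
Proof. exact: big_split. Qed.

Lemma rsum_distrr a g : a * \sum_t g t = \sum_t a * g t.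
Proof. exact: big_distrr. Qed.

Lemma rsum_distrl a g : (\sum_t g t) * a = \sum_t g t * a.
Proof. exact: big_distrl. Qed.

Lemma rsum0 g : (forall t, g t = 0) -> \sum_t g t = 0.
Proof. by move=> g0; apply: big1 => t _. Qed.

Lemma rsum_const a : \sum_(t : T) a = INR #|T| * a.
Proof.
rewrite /rsum big_const; elim: #|T| => [|k IH]; first by rewrite /=; ring.
by rewrite iterS IH S_INR; ring.
Qed.

Lemma rsumD1 t0 g : \sum_t g t = g t0 + \sum_t indic (t != t0) * g t.
Proof.
rewrite /rsum (bigD1 t0) //=; congr (_ + _).
by rewrite big_mkcond; apply: eq_bigr => t _; rewrite /indic; case: ifP => _; ring.
Qed.

Lemma rsum_pick t0 g : \sum_t indic (t == t0) * g t = g t0.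
Proof.
rewrite (rsumD1 t0) eqxx rsum0 /=; first by ring.
by move=> t; case: eqVneq => _ /=; ring.
Qed.

Lemma rsum_indic_eq (t0 : T) : \sum_t indic (t == t0) = 1.
Proof. by rewrite -[RHS](rsum_pick t0 (fun=> 1)); apply: eq_rsum => t; ring. Qed.

Lemma rsum_indic (A : {set T}) : \sum_t indic (t \in A) = INR #|A|.
Proof.
rewrite /rsum /indic -big_mkcond /= -sum1_card.
by symmetry; apply: (big_morph INR) => // m k; exact: plus_INR.
Qed.

Lemma INR_card_ge1 (t0 : T) : 1 <= INR #|T|.
Proof. by rewrite -INR_1; apply/le_INR/leP/card_gt0P; exists t0. Qed.

Lemma le_rsum_term t0 g : (forall t, 0 <= g t) -> g t0 <= \sum_t g t.
Proof.
move=> g0; rewrite (rsumD1 t0).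
suff: 0 <= \sum_t indic (t != t0) * g t by lra.
by apply: rsum_ge0 => t; apply: Rmult_le_pos (indic_ge0 _) (g0 t).
Qed.

Lemma rsum_gt0_term g : 0 < \sum_t g t -> exists t, 0 < g t.
Proof.
move=> g0; apply: NNPP => h.
suff : \sum_t g t <= \sum_(t : T) 0 by rewrite rsum_const; lra.
by apply: rsum_le => t; apply: Rnot_lt_le => gt; apply: h; exists t.
Qed.

Lemma rprod_ge0 g : (forall t, 0 <= g t) -> 0 <= \prod_t g t.
Proof.
by move=> g0; apply: big_ind => [|a b|t _]; [lra|exact: Rmult_le_pos|exact: g0].
Qed.

Lemma rprod_gt0 g : (forall t, 0 < g t) -> 0 < \prod_t g t.
Proof.
by move=> g0; apply: big_ind => [|a b|t _]; [lra|exact: Rmult_lt_0_compat|exact: g0].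
Qed.

Lemma rprod_le g h : (forall t, 0 <= g t <= h t) -> \prod_t g t <= \prod_t h t.
Proof.
move=> gh; suff : 0 <= \prod_t g t <= \prod_t h t by case.
apply: (big_ind2 (fun x y => 0 <= x <= y)) => [|a b c d h1 h2|t _]; [lra| |exact: gh].
by split; [apply: Rmult_le_pos|apply: Rmult_le_compat]; lra.
Qed.

Lemma eq_rprod g h : (forall t, g t = h t) -> \prod_t g t = \prod_t h t.
Proof. by move=> gh; apply: eq_bigr => t _. Qed.

Lemma rprodM g h : \prod_t (g t * h t) = \prod_t g t * \prod_t h t.
Proof. exact: big_split. Qed.

Lemma rprodV g : \prod_t / g t = / \prod_t g t.
Proof.
by symmetry; apply: (big_morph Rinv) => [x y|]; [exact: Rinv_mult|exact: Rinv_1].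
Qed.

Lemma rprod_div g h : \prod_t (g t / h t) = \prod_t g t / \prod_t h t.
Proof. by rewrite rprodM rprodV. Qed.

Lemma rprod_const a : \prod_(t : T) a = a ^ #|T|.
Proof. by rewrite /rprod big_const; elim: #|T| => [|k IH] //=; rewrite IH. Qed.

Lemma rprod1 g : (forall t, g t = 1) -> \prod_t g t = 1.
Proof. by move=> g1; apply: big1 => t _. Qed.

Lemma rprod0 t0 g : g t0 = 0 -> \prod_t g t = 0.
Proof. by move=> g0; rewrite /rprod (bigD1 t0) //= g0 Rmult_0_l. Qed.

Lemma rprod_pick (t0 : T) a : \prod_t (if t == t0 then a else 1) = a.
Proof. by rewrite /rprod -big_mkcond big_pred1_eq. Qed.

Lemma rprod_gt0_term g t : (forall t, 0 <= g t) -> 0 < \prod_t g t -> 0 < g t.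
Proof.
move=> /(_ t) [//|/esym g0]; rewrite (rprod0 g0); lra.
Qed.

Lemma rprod_exp g : \prod_t exp (g t) = exp (\sum_t g t).
Proof.
by symmetry; apply: (big_morph exp) => [x y|]; [exact: exp_plus|exact: exp_0].
Qed.

Lemma ln_rprod g : (forall t, 0 < g t) -> ln (\prod_t g t) = \sum_t ln (g t).
Proof.
move=> g0; rewrite -[RHS]ln_exp -rprod_exp; congr ln.
by apply: eq_rprod => t; rewrite exp_ln.
Qed.

End RealSums.

Lemma exchange_rsum (S T : finType) (g : S -> T -> R) :
  \sum_s \sum_t g s t = \sum_t \sum_s g s t.
Proof. exact: exchange_big. Qed.

Lemma rsum_pair (S T : finType) (g : S * T -> R) :
  \sum_z g z = \sum_s \sum_t g (s, t).
Proof. by rewrite /rsum pair_big; apply: eq_bigr => -[]. Qed.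

Lemma rsum_reindex (S T : finType) (h : S -> T) (g : T -> R) :
  bijective h -> \sum_t g t = \sum_s g (h s).
Proof. by move=> bij; rewrite /rsum (reindex h) //; apply: onW_bij. Qed.

Lemma rsum_rprod (J T : finType) (g : J -> T -> R) :
  \sum_(c : {ffun J -> T}) \prod_j g j (c j) = \prod_j \sum_t g j t.
Proof. by rewrite /rprod bigA_distr_bigA. Qed.

Definition zip_ffun (J S T : finType) (ss : {ffun J -> S}) (ts : {ffun J -> T}) :
  {ffun J -> S * T} := [ffun j => (ss j, ts j)].

Lemma rsum_zip_ffun (J S T : finType) (g : {ffun J -> S * T} -> R) :
  \sum_z g z = \sum_ss \sum_ts g (zip_ffun ss ts).
Proof.
rewrite -(rsum_pair (fun u => g (zip_ffun u.1 u.2))); apply: rsum_reindex.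
exists (fun z : {ffun J -> S * T} => ([ffun j => (z j).1], [ffun j => (z j).2])).
- by case=> ss ts; congr pair; apply/ffunP => j; rewrite !ffunE.
- by move=> z; apply/ffunP => j; rewrite !ffunE /=; case: (z j).
Qed.

(** * Finite distributions *)

Definition distr (T : finType) (mu : T -> R) : Prop :=
  (forall t, 0 <= mu t) /\ \sum_t mu t = 1.

Definition expect (T : finType) (mu g : T -> R) : R := \sum_t mu t * g t.

Definition prob (T : finType) (mu : T -> R) (P : pred T) : R :=
  expect mu (fun t => indic (P t)).

Section Expectation.
Variables (T : finType) (mu : T -> R).
Implicit Types (g h : T -> R) (P : pred T) (a : R).

Lemma eq_expect g h : (forall t, g t = h t) -> expect mu g = expect mu h.
Proof. by move=> gh; apply: eq_rsum => t; rewrite gh. Qed.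

Lemma expectD g h : expect mu (fun t => g t + h t) = expect mu g + expect mu h.
Proof. by rewrite -rsumD; apply: eq_rsum => t; ring. Qed.

Lemma expectZ a g : expect mu (fun t => a * g t) = a * expect mu g.
Proof. by rewrite /expect rsum_distrr; apply: eq_rsum => t; ring. Qed.

Lemma expectN g : expect mu (fun t => - g t) = - expect mu g.
Proof.
rewrite (_ : - expect mu g = -1 * expect mu g); last by ring.
by rewrite -expectZ; apply: eq_expect => t; ring.
Qed.

Lemma expectB g h : expect mu (fun t => g t - h t) = expect mu g - expect mu h.
Proof. by rewrite /Rminus -expectN -expectD. Qed.

Lemma expect_rsum (S : finType) (g : S -> T -> R) :
  expect mu (fun t => \sum_s g s t) = \sum_s expect mu (g s).
Proof. by rewrite exchange_rsum; apply: eq_rsum => t; rewrite rsum_distrr. Qed.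

Hypothesis mu_ge0 : forall t, 0 <= mu t.

Lemma expect_le g h :
  (forall t, 0 < mu t -> g t <= h t) -> expect mu g <= expect mu h.
Proof.
move=> gh; apply: rsum_le => t; case: (mu_ge0 t) => [mu0|<-]; last by lra.
by apply: Rmult_le_compat_l (mu_ge0 t) (gh t mu0).
Qed.

Lemma eq_expect_supp g h :
  (forall t, 0 < mu t -> g t = h t) -> expect mu g = expect mu h.
Proof.
by move=> gh; apply: Rle_antisym; apply: expect_le => t /gh ->; exact: Rle_refl.
Qed.

Lemma expect_ge0 g : (forall t, 0 <= g t) -> 0 <= expect mu g.
Proof. by move=> g0; apply: rsum_ge0 => t; apply: Rmult_le_pos. Qed.

Lemma prob_ge0 P : 0 <= prob mu P.
Proof. by apply: expect_ge0 => t; exact: indic_ge0. Qed.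

Hypothesis mu1 : \sum_t mu t = 1.

Lemma expect_cst a : expect mu (fun=> a) = a.
Proof. by rewrite /expect -rsum_distrl mu1 Rmult_1_l. Qed.

Lemma distr_le1 t : mu t <= 1.
Proof. by rewrite -mu1; exact: le_rsum_term. Qed.

Lemma distr_supp : exists t, 0 < mu t.
Proof. by apply: rsum_gt0_term; rewrite mu1; lra. Qed.

Lemma probN P : prob mu (fun t => ~~ P t) = 1 - prob mu P.
Proof.
rewrite -{1}(expect_cst 1) -expectB.
by apply: eq_expect => t; rewrite indicN.
Qed.

(* Gibbs' inequality, from the tangent line of the logarithm at [a]. *)
Lemma expect_ln_le a g : 0 < a ->
  (forall t, 0 < mu t -> 0 < g t) -> expect mu g <= a ->
  expect mu (fun t => ln (g t)) <= ln a.
Proof.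
move=> a0 g0 ga.
apply: Rle_trans (_ : expect mu (fun t => / a * g t + (ln a - 1)) <= _).
  apply: expect_le => t /g0 gt0.
  have := exp_ineq1_le (ln (/ a * g t)).
  rewrite exp_ln; last by apply: Rmult_lt_0_compat (Rinv_0_lt_compat _ a0) gt0.
  by rewrite ln_mult ?ln_Rinv //; [lra|exact: Rinv_0_lt_compat].
rewrite expectD expectZ expect_cst.
have := Rmult_le_compat_l _ _ _ (Rlt_le _ _ (Rinv_0_lt_compat _ a0)) ga.
by rewrite Rinv_l; lra.
Qed.

End Expectation.

Lemma expect_le_max (T : finType) (t0 : T) (mu g : T -> R) :
  (forall t, 0 <= mu t) -> \sum_t mu t <= 1 -> (forall t, 0 <= g t) ->
  exists t, expect mu g <= g t.
Proof.
move=> mu0 mu1 g0; set m := expect mu g.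
have m0 : 0 <= m by exact: expect_ge0.
apply: NNPP => no_max.
have gm t : g t < m by apply: Rnot_le_lt => mg; apply: no_max; exists t.
have [t mugt] : exists t, 0 < mu t * g t.
  by apply: rsum_gt0_term; rewrite -/(expect mu g) -/m; have := gm t0; have := g0 t0; lra.
have [mut _] := Rmult_gt0_inv (mu0 t) (g0 t) mugt.
have : m < expect mu (fun=> m).
  rewrite {1}/m /expect (rsumD1 t) [X in _ < X](rsumD1 t).
  apply: Rplus_lt_le_compat; first exact: Rmult_lt_compat_l (gm t).
  apply: rsum_le => u; apply: Rmult_le_compat_l (indic_ge0 _) _.
  by apply: Rmult_le_compat_l (mu0 u) (Rlt_le _ _ (gm u)).
by rewrite /expect -rsum_distrl; nra.
Qed.

Definition push (S T : finType) (h : S -> T) (mu : S -> R) (t : T) : R :=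
  \sum_s indic (h s == t) * mu s.

Lemma expect_push (S T : finType) (h : S -> T) (mu : S -> R) (g : T -> R) :
  expect (push h mu) g = expect mu (fun s => g (h s)).
Proof.
rewrite /expect /push; under eq_rsum => t do rewrite rsum_distrl.
rewrite exchange_rsum; apply: eq_rsum => s.
rewrite -(rsum_pick (h s) (fun t => mu s * g t)); apply: eq_rsum => t.
by rewrite eq_sym; ring.
Qed.

Lemma push_ge0 (S T : finType) (h : S -> T) (mu : S -> R) (t : T) :
  (forall s, 0 <= mu s) -> 0 <= push h mu t.
Proof. by move=> mu0; apply: rsum_ge0 => s; apply: Rmult_le_pos (indic_ge0 _) _. Qed.

Lemma push_gt0 (S T : finType) (h : S -> T) (mu : S -> R) (s : S) :
  (forall s, 0 <= mu s) -> 0 < mu s -> 0 < push h mu (h s).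
Proof.
move=> mu0 mus; apply: Rlt_le_trans mus _.
have := @le_rsum_term _ s (fun s' => indic (h s' == h s) * mu s').
by rewrite eqxx Rmult_1_l; apply=> s'; apply: Rmult_le_pos (indic_ge0 _) _.
Qed.

Lemma distr_push (S T : finType) (h : S -> T) (mu : S -> R) :
  distr mu -> distr (push h mu).
Proof.
move=> [mu0 mu1]; split=> [t|]; first exact: push_ge0.
have := expect_push h mu (fun=> 1).
by rewrite /expect -!rsum_distrl mu1 !Rmult_1_r.
Qed.

Definition iid (J T : finType) (mu : T -> R) (c : {ffun J -> T}) : R :=
  \prod_j mu (c j).

Section Iid.
Variables (J T : finType) (mu : T -> R).

Lemma expect_iid_rprod (g : J -> T -> R) :
  expect (@iid J T mu) (fun c => \prod_j g j (c j)) = \prod_j expect mu (g j).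
Proof. by rewrite -rsum_rprod; apply: eq_rsum => c; rewrite rprodM. Qed.

Lemma expect_iid_push (S : finType) (h : T -> S) (g : {ffun J -> S} -> R) :
  expect (@iid J T mu) (fun c => g [ffun j => h (c j)]) = expect (iid (push h mu)) g.
Proof.
rewrite -(expect_push (fun c : {ffun J -> T} => [ffun j => h (c j)])).
apply: eq_rsum => d; congr (_ * _).
rewrite /iid -rsum_rprod; apply: eq_rsum => c; rewrite rprodM; congr (_ * _).
case: eqVneq => [<-|cd] /=.
  by rewrite rprod1 // => j; rewrite ffunE eqxx.
have [j hj] : exists j, h (c j) != d j.
  apply/existsP; rewrite -negb_forall; apply: contra cd => /forallP h_eq.
  by apply/eqP/ffunP => j; rewrite ffunE (eqP (h_eq j)).
by rewrite (@rprod0 _ j) // (negbTE hj).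
Qed.

Hypothesis mu_distr : distr mu.

Lemma iid_ge0 (c : {ffun J -> T}) : 0 <= iid mu c.
Proof. by apply: rprod_ge0 => j; exact: (proj1 mu_distr). Qed.

Lemma iid_gt0_term (c : {ffun J -> T}) j : 0 < iid mu c -> 0 < mu (c j).
Proof.
by apply: (@rprod_gt0_term _ (fun j => mu (c j))) => i; exact: (proj1 mu_distr).
Qed.

Lemma distr_iid : distr (@iid J T mu).
Proof.
split; first exact: iid_ge0.
by rewrite (rsum_rprod (fun _ : J => mu)) rprod1 // (proj2 mu_distr).
Qed.

Lemma expect_iid_coord j (g : T -> R) :
  expect (@iid J T mu) (fun c => g (c j)) = expect mu g.
Proof.
transitivity (expect (@iid J T mu)
    (fun c => \prod_i (if i == j then g (c i) else 1))).
  apply: eq_expect => c; rewrite -[LHS](rprod_pick j); apply: eq_rprod => i.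
  by case: eqP => [->|].
rewrite (expect_iid_rprod (fun i t => if i == j then g t else 1)).
rewrite -[RHS](rprod_pick j); apply: eq_rprod => i.
by case: eqP => // _; apply: expect_cst (proj2 mu_distr) _.
Qed.

Lemma expect_iid_coord2 j k (g h : T -> R) : k != j ->
  expect (@iid J T mu) (fun c => g (c j) * h (c k)) = expect mu g * expect mu h.
Proof.
move=> kj.
pose u i t := (if i == j then g t else 1) * (if i == k then h t else 1).
transitivity (expect (@iid J T mu) (fun c => \prod_i u i (c i))).
  apply: eq_expect => c; rewrite rprodM -[g (c j)](rprod_pick j) -[h (c k)](rprod_pick k).
  by congr (_ * _); apply: eq_rprod => i; case: eqP => [->|].
rewrite expect_iid_rprod -[expect mu g](rprod_pick j) -[expect mu h](rprod_pick k) -rprodM.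
apply: eq_rprod => i; rewrite /u; case: (eqVneq i j) => [->|_].
  rewrite eq_sym (negbTE kj) Rmult_1_r.
  by apply: eq_expect => t; rewrite Rmult_1_r.
rewrite Rmult_1_l; case: eqP => _; last by rewrite Rmult_1_l (expect_cst (proj2 mu_distr)).
by apply: eq_expect => t; rewrite Rmult_1_l.
Qed.

End Iid.

(** * Exponential decay for products of independent factors *)

Lemma exp_le (x y : R) : x <= y -> exp x <= exp y.
Proof. by case=> [xy|->]; [apply/Rlt_le/exp_increasing|exact: Rle_refl]. Qed.

Lemma ln_le (x y : R) : 0 < x -> x <= y -> ln x <= ln y.
Proof. by move=> x0 [xy|->]; [apply/Rlt_le/ln_increasing|exact: Rle_refl]. Qed.

Lemma exp_lt1 (x : R) : x < 0 -> exp x < 1.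
Proof. by rewrite -exp_0; exact: exp_increasing. Qed.

Lemma ln_lt0 (x : R) : 0 < x < 1 -> ln x < 0.
Proof. by move=> [x0 x1]; rewrite -ln_1; exact: ln_increasing. Qed.

Lemma exp_le_quadratic (x : R) : x <= 1 / 2 -> exp x <= 1 + x + 2 * x ^ 2.
Proof.
move=> x_half; have lower := exp_ineq1_le (- x).
have inv : exp x * exp (- x) = 1 by rewrite -exp_plus Rplus_opp_r exp_0.
by have := exp_pos x; nra.
Qed.

Lemma expect_exp_le (T : finType) (mu u : T -> R) (s B : R) :
  distr mu -> (forall t, Rabs (u t) <= B) -> 0 <= s -> s * B <= 1 / 2 ->
  expect mu (fun t => exp (s * u t)) <= 1 + s * expect mu u + 2 * (s * B) ^ 2.
Proof.
move=> [mu0 mu1] uB s0 sB.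
have -> : 1 + s * expect mu u + 2 * (s * B) ^ 2
    = expect mu (fun t => s * u t + (1 + 2 * (s * B) ^ 2)).
  by rewrite expectD expectZ expect_cst //; ring.
apply: expect_le => // t _.
have [lower upper] : - B <= u t <= B by move: (uB t); rewrite /Rabs; case: Rcase_abs; lra.
have su : - (s * B) <= s * u t <= s * B by nra.
by apply: Rle_trans (exp_le_quadratic _) _; nra.
Qed.

Lemma expect_exp_lt1 (T : finType) (mu u : T -> R) :
  distr mu -> expect mu u < 0 ->
  exists s, 0 < s <= 1 /\ expect mu (fun t => exp (s * u t)) < 1.
Proof.
move=> mu_distr; set m := expect mu u => m0.
pose B := 1 + \sum_t Rabs (u t).
have uB t : Rabs (u t) <= B.
  have := @le_rsum_term _ t (fun t => Rabs (u t)) (fun t => Rabs_pos _).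
  by rewrite /B; lra.
have B1 : 1 <= B.
  by rewrite /B; have := @rsum_ge0 _ (fun t => Rabs (u t)) (fun t => Rabs_pos _); lra.
have B2 : 0 < 4 * B ^ 2 by nra.
pose s := Rmin (/ (2 * B)) (- m / (4 * B ^ 2)).
have s0 : 0 < s.
  by apply: Rmin_glb_lt; [apply: Rinv_0_lt_compat; lra|apply: Rdiv_lt_0_compat; lra].
have sB : s * B <= 1 / 2.
  have -> : 1 / 2 = / (2 * B) * B by field; lra.
  by apply: Rmult_le_compat_r; [lra|exact: Rmin_l].
have sBB : s * (4 * B ^ 2) <= - m.
  have -> : - m = - m / (4 * B ^ 2) * (4 * B ^ 2) by field; lra.
  by apply: Rmult_le_compat_r; [lra|exact: Rmin_r].
exists s; split; first by nra.
apply: Rle_lt_trans (expect_exp_le mu_distr uB (Rlt_le _ _ s0) sB) _.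
by rewrite -/m; nra.
Qed.

Lemma Rmin1_exp_le (s x : R) : 0 < s <= 1 -> Rmin 1 (exp x) <= exp (s * x).
Proof.
move=> s01; case: (Rle_lt_dec 0 x) => x0.
  by apply: Rle_trans (Rmin_l _ _) _; rewrite -exp_0; apply: exp_le; nra.
by apply: Rle_trans (Rmin_r _ _) _; apply: exp_le; nra.
Qed.

Lemma Un_cv0_geometric (rho : R) (u : nat -> R) :
  0 <= rho < 1 -> (forall n, 0 <= u n <= rho ^ n) -> Un_cv u 0.
Proof.
move=> [rho0 rho1] u_le eps eps0.
have [|N rhoN] := pow_lt_1_zero rho _ eps eps0; first by rewrite Rabs_pos_eq.
exists N => n /rhoN; have [u0 u_rho] := u_le n.
by rewrite /Rdist Rminus_0_r !Rabs_pos_eq; lra.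
Qed.

Lemma Un_cv0D (u v : nat -> R) : Un_cv u 0 -> Un_cv v 0 -> Un_cv (fun n => u n + v n) 0.
Proof. by move=> u0 v0; rewrite -(Rplus_0_r 0); exact: CV_plus. Qed.

Lemma Un_cv0Z (a : R) (u : nat -> R) : Un_cv u 0 -> Un_cv (fun n => a * u n) 0.
Proof.
move=> u0; rewrite -(Rmult_0_r a); apply: CV_mult u0 => eps eps0.
by exists 0%nat => n _; rewrite Rdist_eq.
Qed.

Lemma Un_cv0_eventually_le (u : nat -> R) (eps : R) :
  Un_cv u 0 -> 0 < eps -> exists N : nat, forall n : nat, (N <= n)%nat -> u n <= eps.
Proof.
move=> u_cv /u_cv [N u_lt]; exists N => n /leP /u_lt.
by rewrite /Rdist Rminus_0_r; have := Rle_abs (u n); lra.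
Qed.

(* Chernoff's bound, with the indicator of a large product relaxed to [Rmin 1]. *)
Lemma iid_rprod_tail (T : finType) (mu r : T -> R) (a : R) :
  distr mu -> (forall t, 0 < mu t -> 0 < r t) -> expect mu (fun t => ln (r t)) < a ->
  Un_cv (fun n => expect (@iid 'I_n T mu) (fun c =>
    Rmin 1 (exp (- (INR n * a)) * \prod_i r (c i)))) 0.
Proof.
move=> mu_distr r0 r_a; have [mu0 mu1] := mu_distr.
have [|s [s01 moment]] := @expect_exp_lt1 _ mu (fun t => ln (r t) - a) mu_distr.
  by rewrite expectB expect_cst //; lra.
apply: (@Un_cv0_geometric (expect mu (fun t => exp (s * (ln (r t) - a))))).
  by split=> //; apply: expect_ge0 => // t; exact: Rlt_le (exp_pos _).
move=> n.
have -> : expect mu (fun t => exp (s * (ln (r t) - a))) ^ n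
    = expect (@iid 'I_n T mu) (fun c => \prod_i exp (s * (ln (r (c i)) - a))).
  by rewrite (expect_iid_rprod _ (fun (_ : 'I_n) t => exp (s * (ln (r t) - a))))
     rprod_const card_ord.
have r_prod c : 0 < @iid 'I_n T mu c ->
    exp (- (INR n * a)) * \prod_i r (c i) = exp (\sum_i (ln (r (c i)) - a)).
  move=> c0; have rc i : 0 < r (c i) by exact/r0/(iid_gt0_term mu_distr i c0).
  rewrite rsumD rsum_const card_ord -ln_rprod // exp_plus exp_ln; last exact: rprod_gt0.
  by rewrite Rmult_comm; congr (_ * exp _); ring.
have iid0 := iid_ge0 (J := 'I_n) mu_distr.
split.
- rewrite -(expect_cst (proj2 (distr_iid 'I_n mu_distr)) 0).
  apply: expect_le => // c /r_prod ->.
  by apply: Rmin_glb; [lra|exact: Rlt_le (exp_pos _)].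
- apply: expect_le => // c /r_prod ->.
  by rewrite rprod_exp -rsum_distrr; exact: Rmin1_exp_le.
Qed.

(** * Random codebooks *)

Lemma Rdiv_self_le1 (x : R) : x / x <= 1.
Proof.
case: (Req_dec x 0) => [->|x0]; first by rewrite /Rdiv Rmult_0_l; lra.
by apply: Req_le; field.
Qed.

Lemma Rdiv_mul_le (x a b : R) : 0 <= x -> 0 <= a <= b -> x / b * a <= x.
Proof.
move=> x0 [a0 ab]; rewrite /Rdiv Rmult_assoc -[X in _ <= X]Rmult_1_r.
apply: Rmult_le_compat_l => //; apply: Rle_trans (Rdiv_self_le1 b); rewrite Rmult_comm.
apply: Rmult_le_compat_r => //; rewrite -[/ b]Rmult_1_l.
by apply: Rdiv_ge0; lra.
Qed.

(* The graph of the convex function [1 / (a b)] lies above its tangent plane at [(a0, b0)]. *)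
Lemma inv_mul_tangent (a b a0 b0 : R) : 0 < a -> 0 < b -> 0 < a0 -> 0 < b0 ->
  / (a0 * b0) * (3 - a / a0 - b / b0) <= / (a * b).
Proof.
move=> ha hb ha0 hb0.
have tangent_at_1 x y : 0 < x -> 0 < y -> (3 - x - y) * (x * y) <= 1.
  move=> x0 y0; have xy0 : 0 < x * y by nra.
  have am_gm : 4 * (x * y) <= (x + y) ^ 2 by have := pow2_ge_0 (x - y); nra.
  case: (Rle_lt_dec 3 (x + y)) => [|xy3]; first by nra.
  have : 0 <= (x + y - 2) ^ 2 * (x + y + 1).
    by apply: Rmult_le_pos; [exact: pow2_ge_0|lra].
  move=> cubic; have : (3 - x - y) * (x + y) ^ 2 <= 4 by nra.
  by nra.
have ab0 : 0 < a * b by nra.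
apply: (Rmult_le_reg_r (a * b)) => //; rewrite Rinv_l; last by lra.
have x0 := Rdiv_lt_0_compat _ _ ha ha0; have y0 := Rdiv_lt_0_compat _ _ hb hb0.
apply: Rle_trans (tangent_at_1 _ _ x0 y0).
by apply: Req_le; field; lra.
Qed.

Section ScoreShare.
Variables (J C : finType).
Implicit Types (s : C -> R) (L : {set J}) (c : {ffun J -> C}).

Definition score_sum s L c : R := \sum_i indic (i \in L) * s (c i).

Definition score_share s L c (j : J) : R := s (c j) / score_sum s L c.

Lemma score_sum_ge0 s L c : (forall v, 0 <= s v) -> 0 <= score_sum s L c.
Proof. by move=> s0; apply: rsum_ge0 => i; apply: Rmult_le_pos (indic_ge0 _) _. Qed.

Lemma score_sum_gt0 s L c j :
  (forall v, 0 <= s v) -> j \in L -> 0 < s (c j) -> 0 < score_sum s L c.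
Proof.
move=> s0 jL sj; apply: Rlt_le_trans sj _.
have := @le_rsum_term _ j (fun i => indic (i \in L) * s (c i)).
by rewrite jL Rmult_1_l; apply=> i; apply: Rmult_le_pos (indic_ge0 _) _.
Qed.

Lemma score_share_ge0 s L c j : (forall v, 0 <= s v) -> 0 <= score_share s L c j.
Proof. by move=> s0; apply: Rdiv_ge0 => //; exact: score_sum_ge0. Qed.

Lemma score_share_sum_le1 s L c : \sum_j indic (j \in L) * score_share s L c j <= 1.
Proof.
apply: Rle_trans (Rdiv_self_le1 (score_sum s L c)); apply: Req_le.
by rewrite /Rdiv {2}/score_sum rsum_distrl; apply: eq_rsum => j; rewrite Rmult_assoc.
Qed.

Variable mu : C -> R.
Hypothesis mu_distr : distr mu.

Lemma expect_score_sum_le (g s : C -> R) L j :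
  (forall v, 0 <= g v) -> expect mu s <= 1 -> j \in L ->
  expect (iid mu) (fun c => g (c j) * score_sum s L c)
    <= expect mu (fun v => g v * (s v + (INR #|L| - 1))).
Proof.
move=> g0 s1 jL.
have -> : INR #|L| - 1 = INR #|L :\ j|.
  by rewrite (cardsD1 j L) jL plus_INR /=; ring.
rewrite (@eq_expect _ _ _ (fun c => g (c j) * s (c j) +
    \sum_i indic (i \in L :\ j) * (g (c j) * s (c i)))); last first.
  move=> c; rewrite /score_sum (rsumD1 j) jL Rmult_1_l Rmult_plus_distr_l rsum_distrr.
  congr (_ + _); apply: eq_rsum => i; rewrite in_setD1.
  by case: (i != j); case: (i \in L) => /=; ring.
rewrite expectD (expect_iid_coord mu_distr j (fun v => g v * s v)) expect_rsum.
rewrite [X in _ <= X](@eq_expect _ mu _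
  (fun v => g v * s v + INR #|L :\ j| * g v)); last first.
  by move=> v; ring.
rewrite expectD expectZ -rsum_indic rsum_distrl; apply: Rplus_le_compat_l; apply: rsum_le => i.
rewrite expectZ in_setD1; case: (boolP (i == j)) => [_|ij] /=; first by lra.
apply: Rmult_le_compat_l (indic_ge0 _) _; rewrite expect_iid_coord2 //.
by have := expect_ge0 (proj1 mu_distr) g0; nra.
Qed.

Lemma expect_score_ratio_le (g s : C -> R) L j (b : R) :
  (forall v, 0 <= g v) -> (forall v, 0 <= s v) -> expect mu s <= 1 -> j \in L ->
  0 <= INR #|L| - 1 <= b ->
  expect (iid mu) (fun c => g (c j) / (s (c j) + b) * score_sum s L c) <= expect mu g.
Proof.
move=> g0 s0 s1 jL Lb; have [mu0 _] := mu_distr.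
have gb0 v : 0 <= g v / (s v + b) by apply: Rdiv_ge0 => //; have := s0 v; lra.
apply: Rle_trans (expect_score_sum_le gb0 s1 jL) _; apply: expect_le => // v _.
by apply: Rdiv_mul_le => //; have := s0 v; lra.
Qed.

Lemma expect_score_shares_ge (r s : C -> R) (K L : {set J}) j (a b : R) :
  (forall v, 0 <= r v) -> (forall v, 0 <= s v) ->
  expect mu r <= 1 -> expect mu s <= 1 -> j \in K -> j \in L ->
  0 <= INR #|K| - 1 <= a -> 0 <= INR #|L| - 1 <= b ->
  expect mu (fun v => r v * s v / ((r v + a) * (s v + b)))
    <= expect (iid mu) (fun c => score_share r K c j * score_share s L c j).
Proof.
move=> r0 s0 r1 s1 jK jL Ka Lb.
pose g v := r v * s v / ((r v + a) * (s v + b)).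
have ra0 v : 0 <= r v + a by have := r0 v; lra.
have sb0 v : 0 <= s v + b by have := s0 v; lra.
have g0 v : 0 <= g v by apply: Rdiv_ge0; apply: Rmult_le_pos.
have iid0 := iid_ge0 (J := J) mu_distr.
apply: Rle_trans (_ : expect (iid mu) (fun c : {ffun J -> C} => 3 * g (c j)
    - g (c j) / (r (c j) + a) * score_sum r K c
    - g (c j) / (s (c j) + b) * score_sum s L c) <= _); last first.
  apply: expect_le => // c _; rewrite /score_share /g.
  case: (r0 (c j)) => [rj|<-]; last by rewrite /Rdiv !Rmult_0_l; lra.
  case: (s0 (c j)) => [sj|<-]; last by rewrite /Rdiv !(Rmult_0_r, Rmult_0_l); lra.
  have rK0 : 0 < score_sum r K c by exact: score_sum_gt0 rj.
  have sL0 : 0 < score_sum s L c by exact: score_sum_gt0 sj.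
  have raj : 0 < r (c j) + a by lra.
  have sbj : 0 < s (c j) + b by lra.
  have rs : 0 <= r (c j) * s (c j) by apply: Rmult_le_pos.
  have := Rmult_le_compat_l _ _ _ rs (inv_mul_tangent rK0 sL0 raj sbj).
  by congr (_ <= _); field; lra.
rewrite !expectB expectZ (expect_iid_coord mu_distr j g).
have gA := expect_score_ratio_le g0 r0 r1 jK Ka.
have gB := expect_score_ratio_le g0 s0 s1 jL Lb.
by rewrite /= -[X in X <= _]/(expect mu g); lra.
Qed.

End ScoreShare.

(** * Joint laws and channels *)

Definition joint (A B : finType) (p : A -> B -> R) : A * B -> R := fun '(a, b) => p a b.

Definition channel (A C : finType) (w : C -> A -> R) : Prop :=
  (forall c a, 0 <= w c a) /\ (forall a, \sum_c w c a = 1).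

Section ChannelLaws.
Variables (A B C : finType) (p : A -> B -> R) (w : C -> A -> R).

Definition channel_law : A * B * C -> R := fun '(a, b, c) => p a b * w c a.

Definition joint_out (c : C) (b : B) : R := \sum_a p a b * w c a.

Definition out_law (c : C) : R := \sum_b joint_out c b.

(* The exponentials of the information densities of [C] with [A] and with [B]. *)
Definition lratio_src (c : C) (a : A) : R := w c a / out_law c.

Definition lratio_side (c : C) (b : B) : R := joint_out c b / (out_law c * pY p b).

End ChannelLaws.

Lemma expect_joint (A B : finType) (p : A -> B -> R) (g : A * B -> R) :
  expect (joint p) g = \sum_a \sum_b p a b * g (a, b).
Proof. exact: rsum_pair. Qed.

Lemma expect_channel_law (A B C : finType) (p : A -> B -> R) (w : C -> A -> R)
    (g : A * B * C -> R) :
  expect (channel_law p w) g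
  = expect (joint p) (fun '(a, b) => expect (w^~ a) (fun c => g (a, b, c))).
Proof.
rewrite /expect rsum_pair; apply: eq_rsum => -[a b] /=.
by rewrite rsum_distrr; apply: eq_rsum => c; rewrite Rmult_assoc.
Qed.

Section JointLaw.
Variables (A B : finType) (p : A -> B -> R).
Hypothesis p_pmf : is_pmf p.

Lemma distr_joint : distr (joint p).
Proof. by have [p0 p1] := p_pmf; split=> [[a b]|]; [exact: p0|rewrite rsum_pair]. Qed.

Lemma pX_gt0 (a : A) (b : B) : 0 < p a b -> 0 < pX p a.
Proof. by move=> ab; apply: Rlt_le_trans ab _; exact: (le_rsum_term b (proj1 p_pmf a)). Qed.

Lemma pY_gt0 (a : A) (b : B) : 0 < p a b -> 0 < pY p b.
Proof.
by move=> ab; apply: Rlt_le_trans ab _; exact: (le_rsum_term a ((proj1 p_pmf)^~ b)).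
Qed.

Lemma distr_pX : distr (pX p).
Proof. by have [p0 p1] := p_pmf; split=> // a; exact: rsum_ge0. Qed.

Lemma distr_pY : distr (pY p).
Proof.
have [p0 p1] := p_pmf; split=> [b|]; first exact: rsum_ge0.
by rewrite exchange_rsum.
Qed.

End JointLaw.

Section Channel.
Variables (A B C : finType) (p : A -> B -> R) (w : C -> A -> R).
Hypotheses (p_pmf : is_pmf p) (w_channel : channel w).

Let p_ge0 := proj1 p_pmf.
Let w_ge0 := proj1 w_channel.

Lemma distr_channel_law : distr (channel_law p w).
Proof.
split=> [[[a b] c]|]; first exact: Rmult_le_pos.
rewrite rsum_pair -(proj2 (distr_joint p_pmf)); apply: eq_rsum => -[a b] /=.
by rewrite -rsum_distrr (proj2 w_channel) Rmult_1_r.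
Qed.

Lemma channel_law_gt0 a b c : 0 < channel_law p w (a, b, c) -> 0 < p a b /\ 0 < w c a.
Proof. by apply: Rmult_gt0_inv. Qed.

Lemma joint_out_ge0 c b : 0 <= joint_out p w c b.
Proof. by apply: rsum_ge0 => a; apply: Rmult_le_pos. Qed.

Lemma joint_out_gt0 a b c : 0 < channel_law p w (a, b, c) -> 0 < joint_out p w c b.
Proof.
move=> abc; apply: Rlt_le_trans abc _.
by apply: (@le_rsum_term _ a (fun a => p a b * w c a)) => a'; apply: Rmult_le_pos.
Qed.

Lemma rsum_joint_out b : \sum_c joint_out p w c b = pY p b.
Proof.
rewrite exchange_rsum; apply: eq_rsum => a.
by rewrite -rsum_distrr (proj2 w_channel) Rmult_1_r.
Qed.

Lemma distr_out_law : distr (out_law p w).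
Proof.
split=> [c|]; first by apply: rsum_ge0 => b; exact: joint_out_ge0.
rewrite exchange_rsum (eq_rsum (h := pY p)); last exact: rsum_joint_out.
exact: (proj2 (distr_pY p_pmf)).
Qed.

Let out_ge0 := proj1 distr_out_law.

Lemma out_law_gt0 a b c : 0 < channel_law p w (a, b, c) -> 0 < out_law p w c.
Proof.
move=> /joint_out_gt0 bc; apply: Rlt_le_trans bc _.
by apply: (@le_rsum_term _ b (joint_out p w c)) => b'; exact: joint_out_ge0.
Qed.

Lemma lratio_src_ge0 c a : 0 <= lratio_src p w c a.
Proof. exact: Rdiv_ge0. Qed.

Lemma lratio_side_ge0 c b : 0 <= lratio_side p w c b.
Proof.
apply: Rdiv_ge0; first exact: joint_out_ge0.
exact: Rmult_le_pos (out_ge0 c) (proj1 (distr_pY p_pmf) b).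
Qed.

Lemma lratio_src_gt0 a b c : 0 < channel_law p w (a, b, c) -> 0 < lratio_src p w c a.
Proof.
move=> abc; have [_ wca] := channel_law_gt0 abc.
exact: Rdiv_lt_0_compat (out_law_gt0 abc).
Qed.

Lemma lratio_side_gt0 a b c : 0 < channel_law p w (a, b, c) -> 0 < lratio_side p w c b.
Proof.
move=> abc; have [pab _] := channel_law_gt0 abc.
apply: Rdiv_lt_0_compat (joint_out_gt0 abc) _.
exact: Rmult_lt_0_compat (out_law_gt0 abc) (pY_gt0 p_pmf pab).
Qed.

Lemma expect_lratio_src_le1 a : expect (out_law p w) (lratio_src p w ^~ a) <= 1.
Proof.
rewrite -(proj2 w_channel a); apply: rsum_le => c.
rewrite Rmult_comm; apply: Rdiv_mul_le => //; split=> //; exact: Rle_refl.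
Qed.

Lemma expect_lratio_side_le1 b : expect (out_law p w) (lratio_side p w ^~ b) <= 1.
Proof.
apply: Rle_trans (Rdiv_self_le1 (pY p b)).
rewrite -{1}rsum_joint_out /Rdiv rsum_distrl; apply: rsum_le => c.
have -> : lratio_side p w c b = joint_out p w c b / pY p b / out_law p w c.
  by rewrite /lratio_side /Rdiv Rinv_mult; ring.
rewrite Rmult_comm; apply: Rdiv_mul_le; last by split=> //; exact: Rle_refl.
exact: Rdiv_ge0 (joint_out_ge0 c b) (proj1 (distr_pY p_pmf) b).
Qed.

End Channel.

(** * One-shot source coding with side information *)

Lemma one_sub_Rmin_le (x : R) : 0 <= x -> 1 - Rmin 1 x <= / (1 + x).
Proof.
move=> x0; have inv : (1 + x) * / (1 + x) = 1 by field; lra.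
by rewrite /Rmin; case: Rle_dec => ?; nra.
Qed.

Lemma one_sub_Rmin2_le (x y N k : R) : 0 < x -> 0 < y -> 0 < N -> 0 <= k ->
  x * (1 - Rmin 1 (x / N) - Rmin 1 (k / y)) / N <= x * y / ((x + N) * (y + k)).
Proof.
move=> x0 y0 N0 k0.
have xN0 : 0 <= x / N by apply: Rdiv_ge0; lra.
have ky0 : 0 <= k / y by apply: Rdiv_ge0; lra.
have minxN := one_sub_Rmin_le xN0; have minky := one_sub_Rmin_le ky0.
have -> : x * y / ((x + N) * (y + k)) = x / N * (/ (1 + x / N) * / (1 + k / y)).
  by field; repeat split; nra.
rewrite (_ : _ / N = x / N * (1 - Rmin 1 (x / N) - Rmin 1 (k / y))); last first.
  by rewrite /Rdiv; ring.
apply: Rmult_le_compat_l => //.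
have m1 : 0 <= Rmin 1 (x / N) <= 1 by split; [apply: Rmin_glb; lra|exact: Rmin_l].
have m2 : 0 <= Rmin 1 (k / y) <= 1 by split; [apply: Rmin_glb; lra|exact: Rmin_l].
by apply: Rle_trans (Rmult_le_compat _ _ _ _ _ _ minxN minky); nra.
Qed.

(* For each value of the observation, the best index does as well as a random one. *)
Lemma derandomize (T S K : finType) (k0 : K) (mu : T -> R) (obs : T -> S)
    (q : S -> K -> R) (g : T -> K -> R) :
  (forall t, 0 <= mu t) -> (forall s k, 0 <= q s k) -> (forall s, \sum_k q s k <= 1) ->
  (forall t k, 0 <= g t k) ->
  exists sel : S -> K,
    expect mu (fun t => \sum_k q (obs t) k * g t k) <= expect mu (fun t => g t (sel (obs t))).
Proof.
move=> mu0 q0 q1 g0.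
pose gain s k := expect mu (fun t => indic (s == obs t) * g t k).
have split_obs (h : S -> T -> R) :
    expect mu (fun t => h (obs t) t) = \sum_s expect mu (fun t => indic (s == obs t) * h s t).
  rewrite -expect_rsum; apply: eq_expect => t.
  by rewrite (rsum_pick (obs t) (h^~ t)).
have [sel sel_max] : exists sel : S -> K, forall s, expect (q s) (gain s) <= gain s (sel s).
  apply: (fin_all_exists (P := fun s k => expect (q s) (gain s) <= gain s k)) => s.
  apply: expect_le_max => // k; apply: expect_ge0 => // t.
  exact: Rmult_le_pos (indic_ge0 _) (g0 t k).
exists sel; rewrite (split_obs (fun s t => \sum_k q s k * g t k)).
rewrite (split_obs (fun s t => g t (sel s))); apply: rsum_le => s.
apply: Rle_trans (sel_max s); apply: Req_le.
rewrite -[RHS]/(\sum_k q s k * gain s k) /gain; under [RHS]eq_rsum => k do rewrite -expectZ.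
rewrite -expect_rsum; apply: eq_expect => t; rewrite rsum_distrr.
by apply: eq_rsum => k; ring.
Qed.

Section OneShot.
Variables (A B C Msg Idx : finType) (p : A -> B -> R) (w : C -> A -> R).
Hypotheses (p_pmf : is_pmf p) (w_channel : channel w).
Variables (m0 : Msg) (k0 : Idx).

Let codebook : finType := {ffun Msg * Idx -> C}.

Definition codebook_row (m : Msg) : {set Msg * Idx} := [set j | j.1 == m].

Lemma card_codebook_row (m : Msg) : #|codebook_row m| = #|Idx|.
Proof.
rewrite -[RHS]mul1n -(cards1 m) -[#|Idx|]cardsT -cardsX.
by apply: eq_card => j; rewrite !inE andbT.
Qed.

(* The probabilities of picking each entry, for an encoder that knows [a] and a
   decoder that knows [b] and the row of the entry. *)
Definition encoder_share (c : codebook) (a : A) : Msg * Idx -> R :=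
  score_share (lratio_src p w ^~ a) setT c.
Definition decoder_share (c : codebook) (b : B) (j : Msg * Idx) : R :=
  score_share (lratio_side p w ^~ b) (codebook_row j.1) c j.
Definition agreement (c : codebook) (z : A * B) : R :=
  \sum_j encoder_share c z.1 j * decoder_share c z.2 j.

Definition union_loss (z : A * B * C) : R :=
  let: (a, b, v) := z in
  Rmin 1 (lratio_src p w v a / (INR #|Msg| * INR #|Idx|)) +
  Rmin 1 ((INR #|Idx| - 1) / lratio_side p w v b).

Lemma encoder_share_ge0 c a j : 0 <= encoder_share c a j.
Proof. by apply: score_share_ge0 => v; exact: lratio_src_ge0. Qed.

Lemma decoder_share_ge0 c b j : 0 <= decoder_share c b j.
Proof. by apply: score_share_ge0 => v; exact: lratio_side_ge0. Qed.

Lemma encoder_share_sum_le1 c a : \sum_j encoder_share c a j <= 1.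
Proof.
apply: Rle_trans (score_share_sum_le1 (lratio_src p w ^~ a) setT c); apply: Req_le.
by apply: eq_rsum => j; rewrite inE Rmult_1_l.
Qed.

Lemma decoder_share_sum_le1 c b m : \sum_k decoder_share c b (m, k) <= 1.
Proof.
apply: Rle_trans (score_share_sum_le1 (lratio_side p w ^~ b) (codebook_row m) c).
rewrite rsum_pair.
have := le_rsum_term m (g := fun i => \sum_k indic ((i, k) \in codebook_row m) *
  score_share (lratio_side p w ^~ b) (codebook_row m) c (i, k)).
rewrite (eq_rsum (h := fun k => decoder_share c b (m, k))); last first.
  by move=> k; rewrite inE eqxx Rmult_1_l.
apply=> i; apply: rsum_ge0 => k; apply: Rmult_le_pos (indic_ge0 _) _.
by apply: score_share_ge0 => v; exact: lratio_side_ge0.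
Qed.

Lemma agreement_ge0 c z : 0 <= agreement c z.
Proof.
apply: rsum_ge0 => j.
exact: Rmult_le_pos (encoder_share_ge0 _ _ _) (decoder_share_ge0 _ _ _).
Qed.

Lemma expect_agreement_ge (a : A) (b : B) : 0 < p a b ->
  expect (w^~ a) (fun v => 1 - union_loss (a, b, v))
    <= expect (iid (out_law p w)) (fun c => agreement c (a, b)).
Proof.
move=> pab; have out_distr := distr_out_law p_pmf w_channel.
set N := INR #|Msg| * INR #|Idx|.
have NE : N = INR #|{: Msg * Idx}| by rewrite card_prod mult_INR.
have N1 : 1 <= N.
  by rewrite NE; exact: INR_card_ge1 (m0, k0).
have k1 : 0 <= INR #|Idx| - 1 by have := INR_card_ge1 k0; lra.
pose overlap v := lratio_src p w v a * lratio_side p w v b /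
  ((lratio_src p w v a + N) * (lratio_side p w v b + (INR #|Idx| - 1))).
apply: Rle_trans (_ : \sum_(j : Msg * Idx) expect (out_law p w) overlap <= _); last first.
  rewrite expect_rsum; apply: rsum_le => j.
  apply: expect_score_shares_ge => //; rewrite ?inE //.
  - by move=> v; exact: lratio_src_ge0.
  - by move=> v; exact: lratio_side_ge0.
  - exact: expect_lratio_src_le1.
  - exact: expect_lratio_side_le1.
  - by rewrite cardsT -NE; lra.
  - by rewrite card_codebook_row; lra.
rewrite rsum_const -NE -expectZ; apply: rsum_le => v.
have [w0 _] := w_channel; case: (w0 v a) => [wva|<-]; last first.
  rewrite Rmult_0_l; apply: Rmult_le_pos; first exact: (proj1 out_distr).
  apply: Rmult_le_pos; first by lra.
  have srcv := lratio_src_ge0 p_pmf w_channel v a.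
  have sidev := lratio_side_ge0 p_pmf w_channel v b.
  by apply: Rdiv_ge0; apply: Rmult_le_pos; lra.
have abv : 0 < channel_law p w (a, b, v) by exact: Rmult_lt_0_compat.
have outv := out_law_gt0 p_pmf w_channel abv.
have wE : w v a = out_law p w v * lratio_src p w v a by rewrite /lratio_src; field; lra.
rewrite {1}wE Rmult_assoc; apply: Rmult_le_compat_l; first exact: Rlt_le.
have := one_sub_Rmin2_le (lratio_src_gt0 p_pmf w_channel abv)
  (lratio_side_gt0 p_pmf w_channel abv) (Rlt_le_trans _ _ _ Rlt_0_1 N1) k1.
move=> /(Rmult_le_compat_l N) overlap_ge.
apply: Rle_trans (overlap_ge _); last by lra.
by apply: Req_le; rewrite /union_loss -/N; field; lra.
Qed.

Lemma codebook_exists :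
  exists c, 1 - expect (channel_law p w) union_loss <= expect (joint p) (agreement c).
Proof.
have iid_distr := distr_iid (Msg * Idx)%type (distr_out_law p_pmf w_channel).
have [iid0 iid1] := iid_distr; have joint0 := proj1 (distr_joint p_pmf).
have [c0 _] := distr_supp iid1.
have [|c c_max] := @expect_le_max _ c0 _ (fun c => expect (joint p) (agreement c))
    iid0 (Req_le _ _ iid1).
  by move=> c; apply: expect_ge0 => // z; exact: agreement_ge0.
exists c; apply: Rle_trans c_max.
rewrite -{1}(expect_cst (proj2 (distr_channel_law p_pmf w_channel)) 1) -expectB.
rewrite expect_channel_law (_ : expect (iid _) _ =
  expect (joint p) (fun z => expect (iid (out_law p w)) (agreement ^~ z))).
  by apply: expect_le => // -[a b] /expect_agreement_ge.
rewrite expect_rsum; apply: eq_rsum => z.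
by rewrite expectZ.
Qed.

Lemma one_shot_side_information :
  exists (enc : A -> Msg) (dec : Msg -> B -> C),
    prob (joint p) (fun z => ~~ Rltb 0 (w (dec (enc z.1) z.2) z.1))
      <= expect (channel_law p w) union_loss.
Proof.
have [c c_good] := codebook_exists.
have [joint0 joint1] := distr_joint p_pmf.
pose ok a j := indic (Rltb 0 (w (c j) a)).
have ok0 a j : 0 <= ok a j by exact: indic_ge0.
have encoder_share_ok a j : encoder_share c a j = encoder_share c a j * ok a j.
  rewrite /ok; case: RltbP => [_|wja] /=; first by rewrite Rmult_1_r.
  have w0 : w (c j) a = 0 by have := proj1 w_channel (c j) a; lra.
  by rewrite /encoder_share /score_share /lratio_src w0 /Rdiv !Rmult_0_l.
have [enc enc_max] := derandomize (m0, k0) fst joint0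
  (encoder_share_ge0 c) (encoder_share_sum_le1 c)
  (fun z j => Rmult_le_pos _ _ (ok0 z.1 j) (decoder_share_ge0 c z.2 j)).
pose same_entry a k := indic (k == (enc a).2) * ok a ((enc a).1, k).
have same0 z k : 0 <= same_entry z k by exact: Rmult_le_pos (indic_ge0 _) (ok0 _ _).
have [dec dec_max] := derandomize k0 (fun z => (z.2, (enc z.1).1)) joint0
  (fun s k => decoder_share_ge0 c s.1 (s.2, k)) (fun s => decoder_share_sum_le1 c s.1 s.2)
  (fun z k => same0 z.1 k).
exists (fun a => (enc a).1), (fun m b => c (m, dec (b, m))).
rewrite probN //; set success := prob _ _.
suff : expect (joint p) (agreement c) <= success by lra.
have agreementE z :
    agreement c z = \sum_j encoder_share c z.1 j * (ok z.1 j * decoder_share c z.2 j).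
  by apply: eq_rsum => j; rewrite {1}encoder_share_ok Rmult_assoc.
have same_entryE z : ok z.1 (enc z.1) * decoder_share c z.2 (enc z.1)
    = \sum_k decoder_share c z.2 ((enc z.1).1, k) * same_entry z.1 k.
  rewrite /same_entry; case: (enc z.1) => m k1 /=.
  rewrite -(rsum_pick k1 (fun k => ok z.1 (m, k) * decoder_share c z.2 (m, k))).
  by apply: eq_rsum => k; ring.
rewrite (eq_expect _ agreementE); apply: Rle_trans enc_max _.
rewrite (eq_expect _ same_entryE); apply: Rle_trans dec_max _.
apply: expect_le => // z _; rewrite -[X in _ <= X]Rmult_1_l.
by apply: Rmult_le_compat_r (indic_ge0 _) (indic_le1 _).
Qed.

End OneShot.

(** * Memoryless sources *)

Lemma nat_floorP (x : R) : 0 <= x ->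
  INR (Z.to_nat (up x - 1)) <= x < INR (Z.to_nat (up x - 1)) + 1.
Proof.
move=> x0; have [x_up up_x] := archimed x.
have up0 : (0 < up x)%Z by apply: lt_IZR; lra.
by rewrite INR_IZR_INZ Z2Nat.id ?minus_IZR; [lra|lia].
Qed.

Lemma msgs_bounds (n : nat) (r : R) :
  INR (msgs n r) <= exp (INR n * (r * ln 2)) < INR (msgs n r) + 1.
Proof. by rewrite -Rmult_assoc; apply: nat_floorP; exact: Rlt_le (exp_pos _). Qed.

Lemma msgs_mul_le (n : nat) (r s : R) :
  INR (msgs n r * msgs n s) <= exp (INR n * ((r + s) * ln 2)).
Proof.
rewrite mult_INR Rmult_plus_distr_r Rmult_plus_distr_l exp_plus.
by apply: Rmult_le_compat (proj1 (msgs_bounds _ _)) (proj1 (msgs_bounds _ _));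
  exact: pos_INR.
Qed.

Lemma ln2_gt0 : 0 < ln 2.
Proof. by have := ln_lt_2; lra. Qed.

Lemma msgs_gt0 (n : nat) (r : R) : 0 <= r -> (0 < msgs n r)%nat.
Proof.
move=> r0; have [_ lower] := msgs_bounds n r; apply/ltP/INR_lt.
have : exp 0 <= exp (INR n * (r * ln 2)).
  apply: exp_le; apply: Rmult_le_pos (pos_INR n) _.
  exact: Rmult_le_pos r0 (Rlt_le _ _ ln2_gt0).
by rewrite exp_0 /=; lra.
Qed.

Lemma msgs_ge_half (n : nat) (r : R) :
  0 <= r -> exp (INR n * (r * ln 2)) <= 2 * INR (msgs n r).
Proof.
move=> r0; have [_ lower] := msgs_bounds n r.
have : 1 <= INR (msgs n r) by rewrite -INR_1; apply/le_INR/ltP/msgs_gt0.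
by lra.
Qed.

Lemma exp_INR_mult (n : nat) (x : R) : exp (INR n * x) = exp x ^ n.
Proof. by rewrite -Rpower_pow ?/Rpower ?ln_exp //; exact: exp_pos. Qed.

Lemma Rmin1_scale_le (a x y : R) : 1 <= a -> 0 <= y -> x <= a * y -> Rmin 1 x <= a * Rmin 1 y.
Proof. by move=> a1 y0 xy; rewrite /Rmin; do 2 case: Rle_dec => ?; nra. Qed.

Local Notation nfold p n := (@Pn _ _ p n).

Definition iid_channel (X V : finType) (w : V -> X -> R) (n : nat)
    (vs : {ffun 'I_n -> V}) (xs : {ffun 'I_n -> X}) : R :=
  \prod_i w (vs i) (xs i).

Arguments iid_channel {X V} w n vs xs.

Section SourcePowers.
Variables (X Y : finType) (p : X -> Y -> R).
Hypothesis p_pmf : is_pmf p.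

Lemma Pn_iid (n : nat) (xs : {ffun 'I_n -> X}) (ys : {ffun 'I_n -> Y}) :
  Pn p xs ys = iid (joint p) (zip_ffun xs ys).
Proof. by apply: eq_bigr => i _; rewrite ffunE. Qed.

Lemma expect_Pn (n : nat) (g : {ffun 'I_n -> X * Y} -> R) :
  expect (joint (nfold p n)) (fun z => g (zip_ffun z.1 z.2)) = expect (iid (joint p)) g.
Proof.
rewrite expect_joint /expect rsum_zip_ffun; apply: eq_rsum => xs; apply: eq_rsum => ys.
by rewrite Pn_iid.
Qed.

Lemma Pn_pmf (n : nat) : is_pmf (nfold p n).
Proof.
have [iid0 iid1] := distr_iid 'I_n (distr_joint p_pmf).
split=> [xs ys|]; first by rewrite Pn_iid.
rewrite -iid1 rsum_zip_ffun; apply: eq_rsum => xs; apply: eq_rsum => ys.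
exact: Pn_iid.
Qed.

Lemma Pn_gt0_term (n : nat) (xs : {ffun 'I_n -> X}) (ys : {ffun 'I_n -> Y}) i :
  0 < Pn p xs ys -> 0 < p (xs i) (ys i).
Proof.
by rewrite Pn_iid => /(iid_gt0_term (distr_joint p_pmf) i); rewrite ffunE.
Qed.

Lemma pY_Pn (n : nat) (ys : {ffun 'I_n -> Y}) : pY (nfold p n) ys = \prod_i pY p (ys i).
Proof. exact: (rsum_rprod (fun i x => p x (ys i))). Qed.

Variables (V : finType) (w : V -> X -> R).

Lemma expect_channel_law_Pn (n : nat) (g : {ffun 'I_n -> X * Y * V} -> R) :
  expect (channel_law (nfold p n) (iid_channel w n))
    (fun z => g (zip_ffun (zip_ffun z.1.1 z.1.2) z.2))
  = expect (iid (channel_law p w)) g.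
Proof.
rewrite /expect !rsum_pair [RHS]rsum_zip_ffun [RHS]rsum_zip_ffun.
apply: eq_rsum => xs; apply: eq_rsum => ys; apply: eq_rsum => vs; congr (_ * _).
rewrite [LHS](_ : _ = \prod_i (p (xs i) (ys i) * w (vs i) (xs i))); last by rewrite rprodM.
by apply: eq_rprod => i; rewrite !ffunE.
Qed.

Lemma joint_out_Pn (n : nat) (vs : {ffun 'I_n -> V}) (ys : {ffun 'I_n -> Y}) :
  joint_out (nfold p n) (iid_channel w n) vs ys = \prod_i joint_out p w (vs i) (ys i).
Proof.
rewrite -(rsum_rprod (fun i x => p x (ys i) * w (vs i) x)).
by apply: eq_rsum => xs; rewrite rprodM.
Qed.

Lemma out_law_Pn (n : nat) (vs : {ffun 'I_n -> V}) :
  out_law (nfold p n) (iid_channel w n) vs = \prod_i out_law p w (vs i).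
Proof.
rewrite -(rsum_rprod (fun i y => joint_out p w (vs i) y)).
by apply: eq_rsum => ys; exact: joint_out_Pn.
Qed.

Lemma lratio_src_Pn (n : nat) (vs : {ffun 'I_n -> V}) (xs : {ffun 'I_n -> X}) :
  lratio_src (nfold p n) (iid_channel w n) vs xs = \prod_i lratio_src p w (vs i) (xs i).
Proof. by rewrite /lratio_src out_law_Pn rprod_div. Qed.

Lemma lratio_side_Pn (n : nat) (vs : {ffun 'I_n -> V}) (ys : {ffun 'I_n -> Y}) :
  lratio_side (nfold p n) (iid_channel w n) vs ys = \prod_i lratio_side p w (vs i) (ys i).
Proof. by rewrite /lratio_side joint_out_Pn out_law_Pn pY_Pn rprod_div rprodM. Qed.

Hypothesis w_channel : channel w.

Lemma channel_iid (n : nat) : channel (iid_channel w n).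
Proof.
have [w0 w1] := w_channel; split=> [vs xs|xs]; first by apply: rprod_ge0.
by rewrite (rsum_rprod (fun i v => w v (xs i))) rprod1.
Qed.

Lemma channel_law_Pn_tail (r : X * Y * V -> R) (a : R) :
  (forall z, 0 < channel_law p w z -> 0 < r z) ->
  expect (channel_law p w) (fun z => ln (r z)) < a ->
  Un_cv (fun n => expect (channel_law (nfold p n) (iid_channel w n)) (fun z =>
    Rmin 1 (exp (- (INR n * a)) * \prod_i r (z.1.1 i, z.1.2 i, z.2 i)))) 0.
Proof.
move=> r0 r_a.
have := iid_rprod_tail (distr_channel_law p_pmf w_channel) r0 r_a.
apply: Un_cv_ext => n; rewrite -expect_channel_law_Pn; apply: eq_expect => z.
by congr (Rmin 1 (_ * _)); apply: eq_rprod => i; rewrite !ffunE.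
Qed.

End SourcePowers.

(** * Source coding with side information *)

Section SideInformation.
Variables (X Y V : finType) (p : X -> Y -> R) (w : V -> X -> R).
Hypotheses (p_pmf : is_pmf p) (w_channel : channel w).

(* In nats: I(V; X) and I(V; Y). *)
Definition info_src : R :=
  expect (channel_law p w) (fun '(x, y, v) => ln (lratio_src p w v x)).

Definition info_side : R :=
  expect (channel_law p w) (fun '(x, y, v) => ln (lratio_side p w v y)).

Definition src_loss (a : R) (n : nat) : R :=
  expect (channel_law (nfold p n) (iid_channel w n)) (fun z =>
    Rmin 1 (exp (- (INR n * a)) * lratio_src (nfold p n) (iid_channel w n) z.2 z.1.1)).

Definition side_loss (a : R) (n : nat) : R :=
  expect (channel_law (nfold p n) (iid_channel w n)) (fun z =>
    Rmin 1 (exp (INR n * a) / lratio_side (nfold p n) (iid_channel w n) z.2 z.1.2)).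

Lemma src_loss_cv0 (a : R) : info_src < a -> Un_cv (src_loss a) 0.
Proof.
move=> info_a.
have := @channel_law_Pn_tail _ _ _ p_pmf _ _ w_channel
  (fun z => lratio_src p w z.2 z.1.1) a.
rewrite (@eq_expect _ _ _ (fun '(x, y, v) => ln (lratio_src p w v x))); last by move=> [[]].
move=> /(_ _ info_a) cv0; apply: Un_cv_ext (cv0 _) => [n|[[x y] v]].
  by apply: eq_expect => z; rewrite lratio_src_Pn.
exact: lratio_src_gt0.
Qed.

Lemma side_loss_cv0 (a : R) : a < info_side -> Un_cv (side_loss a) 0.
Proof.
move=> a_info.
have side0 z : 0 < channel_law p w z -> 0 < lratio_side p w z.2 z.1.2.
  by move: z => [[x y] v]; exact: lratio_side_gt0.
have := @channel_law_Pn_tail _ _ _ p_pmf _ _ w_channel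
  (fun z => / lratio_side p w z.2 z.1.2) (- a).
rewrite (@eq_expect_supp _ _ _ _ (fun z => - ln (lratio_side p w z.2 z.1.2))); first last.
- by move=> z /side0 ?; rewrite ln_Rinv.
- exact: (proj1 (distr_channel_law p_pmf w_channel)).
rewrite expectN (@eq_expect _ _ _ (fun '(x, y, v) => ln (lratio_side p w v y))); last first.
  by move=> [[]].
rewrite -/info_side => cv0; apply: Un_cv_ext (cv0 _ _) => [n|z /side0|]; last by lra.
- apply: eq_expect => z; rewrite lratio_side_Pn rprodV.
  by congr (Rmin 1 (exp _ * _)); ring.
- exact: Rinv_0_lt_compat.
Qed.

Lemma side_information_coding (r : R) :
  0 <= r -> info_src - info_side < r * ln 2 ->
  exists2 u, Un_cv u 0 & forall n,
    exists (enc : {ffun 'I_n -> X} -> 'I_(msgs n r))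
           (dec : 'I_(msgs n r) -> {ffun 'I_n -> Y} -> {ffun 'I_n -> V}),
      prob (joint (nfold p n))
        (fun z => ~~ Rltb 0 (iid_channel w n (dec (enc z.1) z.2) z.1)) <= u n.
Proof.
move=> r0 info_r.
pose a := (info_src + info_side + r * ln 2) / 2; pose b := a - r * ln 2.
exists (fun n => 2 * src_loss a n + side_loss b n).
  apply: Un_cv0D; first by apply: Un_cv0Z; apply: src_loss_cv0; rewrite /a; lra.
  by apply: side_loss_cv0; rewrite /b /a; lra.
move=> n; pose k := Z.to_nat (up (exp (INR n * b)) - 1).
have [k_le k_gt] := nat_floorP (Rlt_le _ _ (exp_pos (INR n * b))).
rewrite -/k in k_le k_gt.
have [enc [dec failure]] := @one_shot_side_information _ _ _ _ 'I_k.+1 _ _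
  (Pn_pmf p_pmf n) (channel_iid w_channel n) (Ordinal (msgs_gt0 n r0)) ord0.
exists enc, dec; apply: Rle_trans failure _.
rewrite /src_loss /side_loss -expectZ -expectD.
have [law_ge0 _] := distr_channel_law (Pn_pmf p_pmf n) (channel_iid w_channel n).
apply: expect_le => // -[[xs ys] vs] law0; rewrite /union_loss !card_ord [X in _ <= X]/=.
have src0 := lratio_src_gt0 (Pn_pmf p_pmf n) (channel_iid w_channel n) law0.
have side0 := lratio_side_gt0 (Pn_pmf p_pmf n) (channel_iid w_channel n) law0.
have exp_a_le : exp (INR n * a) <= 2 * (INR (msgs n r) * INR k.+1).
  rewrite (_ : INR n * a = INR n * (r * ln 2) + INR n * b); last by rewrite /b; ring.
  rewrite exp_plus S_INR -[X in _ <= X]Rmult_assoc.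
  by apply: Rmult_le_compat (msgs_ge_half n r0) _; try exact: Rlt_le (exp_pos _); lra.
have exp_a0 := exp_pos (INR n * a).
apply: Rplus_le_compat.
- apply: Rmin1_scale_le; first lra.
    exact: Rmult_le_pos (Rlt_le _ _ (exp_pos _)) (Rlt_le _ _ src0).
  rewrite exp_Ropp /Rdiv [_ * / _]Rmult_comm -Rmult_assoc.
  apply: Rmult_le_compat_r; first exact: Rlt_le.
  rewrite -[2]Rinv_inv -Rinv_mult; apply: Rinv_le_contravar; lra.
- apply: Rle_min_compat_l; apply: Rmult_le_compat_r; last by rewrite S_INR; lra.
  exact/Rlt_le/Rinv_0_lt_compat.
Qed.

End SideInformation.

(** * Source coding at the entropy *)

Definition entropy (T : finType) (mu : T -> R) : R := - \sum_t plogp (mu t).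

Lemma card_le_code (T : finType) (t0 : T) (S : {set T}) (M : nat) :
  (0 < M)%nat -> (#|S| <= M)%nat ->
  exists (e : T -> 'I_M) (d : 'I_M -> T), forall t, t \in S -> d (e t) = t.
Proof.
case: M => // M _ SM.
exists (fun t => inord (index t (enum S))), (fun i => nth t0 (enum S) i) => t tS.
have tE : t \in enum S by rewrite mem_enum.
rewrite inordK ?nth_index //; apply: leq_trans SM.
by rewrite cardE index_mem.
Qed.

Lemma card_likely_le (T : finType) (mu : T -> R) (a : R) :
  distr mu -> 0 <= a -> INR #|[set t | Rltb 1 (a * mu t)]| <= a.
Proof.
move=> [mu0 mu1] a0.
rewrite -rsum_indic -[X in _ <= X]Rmult_1_r -mu1 rsum_distrr; apply: rsum_le => t.
by rewrite inE; case: RltbP => /= [|_]; [lra|exact: Rmult_le_pos].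
Qed.

Section SourceCoding.
Variables (T : finType) (mu : T -> R).
Hypothesis mu_distr : distr mu.

Lemma expect_ln_self : expect mu (fun t => ln (mu t)) = - (entropy mu * ln 2).
Proof.
have [mu0 _] := mu_distr.
rewrite /entropy Ropp_mult_distr_l Ropp_involutive rsum_distrl; apply: eq_rsum => t.
rewrite /plogp /Defs.log2; case: Rlt_dec => /= [_|mut].
  by field; have := ln2_gt0; lra.
have -> : mu t = 0 by have := mu0 t; lra.
by ring.
Qed.

Lemma entropy_ge0 : 0 <= entropy mu.
Proof.
have [mu0 mu1] := mu_distr.
suff : expect mu (fun t => ln (mu t)) <= ln 1.
  by rewrite expect_ln_self ln_1; have := ln2_gt0; nra.
rewrite -[X in _ <= X](expect_cst mu1); apply: expect_le => // t mut.
by apply: ln_le => //; exact: distr_le1.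
Qed.

(* Only the words of probability above the inverse of the number of messages are encoded. *)
Lemma source_coding (r : R) : entropy mu < r ->
  exists2 u, Un_cv u 0 & forall n,
    exists (e : {ffun 'I_n -> T} -> 'I_(msgs n r)) (d : 'I_(msgs n r) -> {ffun 'I_n -> T}),
      prob (iid mu) (fun c => d (e c) != c) <= u n.
Proof.
move=> entropy_r; have [mu0 _] := mu_distr.
have r0 : 0 <= r by have := entropy_ge0; lra.
have cv0 : Un_cv (fun n => expect (@iid 'I_n T mu) (fun c =>
    Rmin 1 (exp (- (INR n * (r * ln 2))) * \prod_i / mu (c i)))) 0.
  apply: (iid_rprod_tail (r := fun t => / mu t)) => // [t|].
    exact: Rinv_0_lt_compat.
  rewrite (@eq_expect_supp _ _ _ _ (fun t => - ln (mu t))) //; last first.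
    by move=> t; exact: ln_Rinv.
  by rewrite expectN expect_ln_self; have := ln2_gt0; nra.
eexists; first exact: Un_cv0Z 2 _ cv0.
move=> n; pose M := msgs n r.
have [iid0 iid1] := distr_iid 'I_n mu_distr; have [c0 _] := distr_supp iid1.
have SM : (#|[set c | Rltb 1 (INR M * @iid 'I_n T mu c)]| <= M)%nat.
  apply/leP/INR_le; apply: card_likely_le (pos_INR M); exact: distr_iid.
have [e [d ed]] := card_le_code c0 (msgs_gt0 n r0) SM.
exists e, d; rewrite -expectZ; apply: expect_le => // c c_pos.
rewrite rprodV -/(iid mu c) exp_Ropp -Rinv_mult; set E := exp _.
have EQ0 : 0 < E * iid mu c by apply: Rmult_lt_0_compat => //; exact: exp_pos.
have EQV0 := Rinv_0_lt_compat _ EQ0.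
case: (boolP (c \in [set c | Rltb 1 (INR M * iid mu c)])) => [/ed ->|].
  by rewrite eqxx; apply: Rmult_le_pos; [|apply: Rmin_glb]; lra.
rewrite inE => /RltbP /Rnot_lt_le MQ1.
apply: Rle_trans (indic_le1 _) _; rewrite -{1}(Rmin_left 1 1); last by lra.
apply: Rmin1_scale_le; [lra|exact: Rlt_le|].
have EQ2 : E * iid mu c <= 2.
  have := Rmult_le_compat_r _ _ _ (Rlt_le _ _ c_pos) (msgs_ge_half n r0).
  by rewrite -/E -/M; lra.
rewrite -(Rinv_r 2); last by lra.
by apply: Rmult_le_compat_l; [lra|exact: Rinv_le_contravar].
Qed.

Lemma small_set_prob_cv0 (a : R) : a < entropy mu * ln 2 ->
  exists2 u, Un_cv u 0 & forall n (S : {set {ffun 'I_n -> T}}),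
    INR #|S| <= exp (INR n * a) -> prob (iid mu) (fun c => c \in S) <= u n.
Proof.
move=> a_entropy.
pose b := (a + entropy mu * ln 2) / 2.
have tail_cv0 : Un_cv (fun n => expect (@iid 'I_n T mu) (fun c =>
    Rmin 1 (exp (- (INR n * - b)) * \prod_i mu (c i)))) 0.
  by apply: iid_rprod_tail => //; rewrite expect_ln_self /b; lra.
have exp_cv0 : Un_cv (fun n => exp (INR n * (a - b))) 0.
  apply: (@Un_cv0_geometric (exp (a - b))).
    by split; [exact: Rlt_le (exp_pos _)|apply: exp_lt1; rewrite /b; lra].
  by move=> n; rewrite -exp_INR_mult; split; [exact: Rlt_le (exp_pos _)|exact: Rle_refl].
eexists; first exact: Un_cv0D tail_cv0 exp_cv0.
move=> n S cardS; have [iid0 _] := distr_iid 'I_n mu_distr.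
set t := exp (- (INR n * b)).
have t0 : 0 < t by exact: exp_pos.
have tV : exp (- (INR n * - b)) * t = 1.
  by rewrite -exp_plus -exp_0; congr exp; ring.
apply: Rle_trans (_ : _ + INR #|S| * t <= _); last first.
  apply: Rplus_le_compat_l.
  rewrite (_ : INR n * (a - b) = INR n * a + - (INR n * b)); last by ring.
  by rewrite exp_plus -/t; apply: Rmult_le_compat_r; lra.
rewrite -rsum_indic rsum_distrl -rsumD; apply: rsum_le => c; rewrite -/(iid mu c).
set q := iid mu c; have q0 : 0 <= q by exact: iid0.
set E := exp _ in tV *; have E0 : 0 < E by exact: exp_pos.
have Eqq : 0 <= q * (E * q) by do 2?apply: Rmult_le_pos => //; lra.
rewrite /Rmin; case: (c \in S) => /=; case: Rle_dec => [_|/Rnot_le_lt Eq1]; try lra.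
have : t * (E * q) <= t * 1 by apply: Rmult_le_compat_l; lra.
by rewrite -Rmult_assoc [t * E]Rmult_comm tV; lra.
Qed.

End SourceCoding.

Section FunctionCoding.
Variables (X Y F : finType) (p : X -> Y -> R) (f : X -> Y -> F).
Hypothesis p_pmf : is_pmf p.

Lemma pf_push (z : F) : pf p f z = push (fun u => f u.1 u.2) (joint p) z.
Proof.
rewrite /push rsum_pair; apply: eq_rsum => x; apply: eq_rsum => y /=.
by case: eqP => _ /=; ring.
Qed.

Lemma distr_pf : distr (pf p f).
Proof.
have [push0 push1] := distr_push (fun u => f u.1 u.2) (distr_joint p_pmf).
split=> [z|]; first by rewrite pf_push.
by rewrite -push1; apply: eq_rsum => z; exact: pf_push.
Qed.

Lemma expect_fseq (n : nat) (g : {ffun 'I_n -> F} -> R) :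
  expect (joint (nfold p n)) (fun z => g (fseq f z.1 z.2)) = expect (iid (pf p f)) g.
Proof.
transitivity (expect (iid (push (fun u => f u.1 u.2) (joint p))) g).
  rewrite -expect_iid_push -expect_Pn; apply: eq_expect => z.
  by congr g; apply/ffunP => i; rewrite !ffunE.
apply: eq_rsum => c; congr (_ * _).
by apply: eq_rprod => i; rewrite pf_push.
Qed.

Lemma err_probE (n M0 MX MY : nat)
    (phi0 : {ffun 'I_n -> X} -> 'I_M0) (phiX : {ffun 'I_n -> X} -> 'I_MX)
    (phiY : {ffun 'I_n -> Y} -> 'I_M0 -> 'I_MY)
    (psi : 'I_MX -> 'I_MY -> {ffun 'I_n -> F}) :
  err_prob p f phi0 phiX phiY psi
  = prob (joint (nfold p n)) (fun z => psi (phiX z.1) (phiY z.2 (phi0 z.1)) != fseq f z.1 z.2).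
Proof.
rewrite /prob expect_joint; apply: eq_rsum => xs; apply: eq_rsum => ys /=.
by case: eqP => _ /=; ring.
Qed.

Lemma function_coding (r : R) : entropy_f p f < r ->
  exists2 u, Un_cv u 0 & forall n,
    exists (e : {ffun 'I_n -> F} -> 'I_(msgs n r)) (d : 'I_(msgs n r) -> {ffun 'I_n -> F}),
      prob (joint (nfold p n)) (fun z => d (e (fseq f z.1 z.2)) != fseq f z.1 z.2) <= u n.
Proof.
move=> /(source_coding distr_pf) [u u_cv0 code]; exists u => // n.
have [e [d ed]] := code n; exists e, d.
by rewrite /prob (expect_fseq (fun c => indic (d (e c) != c))).
Qed.

Lemma function_rate_converse (a b c : R) :
  achievable p f a b c -> entropy_f p f <= b + c.
Proof.
move=> ach; apply: Rnot_lt_le => rate_lt.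
have [|u u_cv0 small] := @small_set_prob_cv0 _ _ distr_pf ((b + c) * ln 2).
  exact: Rmult_lt_compat_r ln2_gt0 rate_lt.
have quarter0 : 0 < 1 / 4 by lra.
have [N1 u_le] := Un_cv0_eventually_le u_cv0 quarter0.
have [N2 code] := ach _ quarter0.
pose n := maxn N1 N2.
have [phi0 [phiX [phiY [psi]]]] := code n (leq_maxr _ _).
rewrite err_probE => err_le.
pose S := [set psi m.1 m.2 | m in [set: 'I_(msgs n b) * 'I_(msgs n c)]].
have cardS : INR #|S| <= exp (INR n * ((b + c) * ln 2)).
  apply: Rle_trans (le_INR _ _ (elimT leP (leq_imset_card _ _))) _.
  by rewrite cardsT card_prod !card_ord; exact: msgs_mul_le.
have S_le := Rle_trans _ _ _ (small n S cardS) (u_le n (leq_maxl _ _)).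
have [joint0 joint1] := distr_joint (Pn_pmf p_pmf n).
suff : 1 <= 1 / 4 + 1 / 4 by lra.
apply: Rle_trans (Rplus_le_compat _ _ _ _ err_le S_le).
rewrite /prob -(expect_fseq (fun c => indic (c \in S))) -expectD -{1}(expect_cst joint1 1).
apply: expect_le => // z _; case: eqVneq => [<-|_].
  rewrite (_ : _ \in S) /=; first by lra.
  by apply/imsetP; exists (phiX z.1, phiY z.2 (phi0 z.1)).
by have := indic_ge0 (fseq f z.1 z.2 \in S); rewrite [indic (~~ false)]/=; lra.
Qed.

End FunctionCoding.

(** * Conditional graph entropy *)

Lemma Rinf_glb (E : R -> Prop) (lb : R) :
  (exists x, E x) -> (forall x, E x -> lb <= x) -> is_glb E (Rinf E).
Proof.
move=> [x0 Ex0] lbE; rewrite /Rinf.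
case: excluded_middle_informative => [has_glb|]; first exact: proj2_sig.
case; have [||m [m_ub m_lub]] := completeness (fun y => E (- y)).
- by exists (- lb) => y /lbE; lra.
- by exists (- x0); rewrite Ropp_involutive.
exists (- m); split=> [x Ex|m' m'E].
  by have : - x <= m by [apply: m_ub; rewrite Ropp_involutive]; lra.
by have : m <= - m' by [apply: m_lub => y /m'E; lra]; lra.
Qed.

Section ConditionalInformation.
Variables (X Y V : finType) (p : X -> Y -> R) (w : V -> X -> R).

(* P(v | x) / P(v | y) *)
Definition lratio_cond (v : V) (x : X) (y : Y) : R := w v x * pY p y / joint_out p w v y.

Definition cond_info : R :=
  expect (channel_law p w) (fun '(x, y, v) => ln (lratio_cond v x y)).

Hypotheses (p_pmf : is_pmf p) (w_channel : channel w).

Lemma lratio_cond_gt0 x y v : 0 < channel_law p w (x, y, v) -> 0 < lratio_cond v x y.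
Proof.
move=> xyv; have [pxy wvx] := channel_law_gt0 p_pmf w_channel xyv.
apply: Rdiv_lt_0_compat (joint_out_gt0 p_pmf w_channel xyv).
exact: Rmult_lt_0_compat wvx (pY_gt0 p_pmf pxy).
Qed.

Lemma cond_infoE : cond_info = info_src p w - info_side p w.
Proof.
have [law0 _] := distr_channel_law p_pmf w_channel.
rewrite /info_src /info_side -expectB; apply: eq_expect_supp => // -[[x y] v] xyv.
have src0 := lratio_src_gt0 p_pmf w_channel xyv.
have side0 := lratio_side_gt0 p_pmf w_channel xyv.
have [pxy _] := channel_law_gt0 p_pmf w_channel xyv.
have := joint_out_gt0 p_pmf w_channel xyv; have := out_law_gt0 p_pmf w_channel xyv.
have := pY_gt0 p_pmf pxy => pY0 out0 vy0.
have -> : lratio_cond v x y = lratio_src p w v x * / lratio_side p w v y.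
  by rewrite /lratio_cond /lratio_src /lratio_side; field; lra.
by rewrite ln_mult ?ln_Rinv //; exact: Rinv_0_lt_compat.
Qed.

Lemma cond_info_ge0 : 0 <= cond_info.
Proof.
have [law0 law1] := distr_channel_law p_pmf w_channel.
have [joint0 joint1] := distr_joint p_pmf.
suff : - cond_info <= ln 1 by rewrite ln_1; lra.
rewrite -expectN (@eq_expect_supp _ _ law0 _
  (fun z => ln (/ lratio_cond z.2 z.1.1 z.1.2))); last first.
  by move=> [[x y] v] /lratio_cond_gt0 ratio0; rewrite ln_Rinv.
apply: expect_ln_le => //; first lra.
  by move=> [[x y] v] /lratio_cond_gt0 ratio0; exact: Rinv_0_lt_compat.
rewrite expect_channel_law -[X in _ <= X](expect_cst joint1).
apply: expect_le => // -[x y] pxy; apply: Rle_trans (Rdiv_self_le1 (pY p y)).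
rewrite -{1}(rsum_joint_out p w_channel) /Rdiv rsum_distrl; apply: rsum_le => v.
have vy0 := joint_out_ge0 p_pmf w_channel v y; have y0 := pY_gt0 p_pmf pxy.
have ratio0 := Rdiv_ge0 vy0 (Rlt_le _ _ y0).
case: (proj1 w_channel v x) => [wvx|<-]; last by rewrite Rmult_0_l.
have vy1 : 0 < joint_out p w v y.
  by apply: (joint_out_gt0 p_pmf w_channel (a := x)); exact: Rmult_lt_0_compat.
by apply: Req_le; rewrite /lratio_cond /=; field; lra.
Qed.

End ConditionalInformation.

Section GraphEntropy.
Variables (X Y F : finType) (p : X -> Y -> R) (f : X -> Y -> F).
Hypothesis p_pmf : is_pmf p.

Lemma cond_MI_cond_info (w : {set X} -> X -> R) :
  channel w -> cond_MI p w * ln 2 = cond_info p w.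
Proof.
move=> w_channel; rewrite /cond_MI rsum_distrl /cond_info /expect !rsum_pair.
rewrite [RHS](eq_rsum (h := fun x => \sum_v \sum_y channel_law p w (x, y, v) *
  ln (lratio_cond p w v x y))); last by move=> x; rewrite exchange_rsum.
rewrite [RHS]exchange_rsum; apply: eq_rsum => v; rewrite rsum_distrl.
apply: eq_rsum => x; rewrite rsum_distrl; apply: eq_rsum => y.
rewrite /Defs.log2; case: Rlt_dec => [xyv|] /=; last first.
  have := Rmult_le_pos _ _ (proj1 p_pmf x y) (proj1 w_channel v x).
  by case=> [//|<-]; rewrite !Rmult_0_l.
have := joint_out_gt0 p_pmf w_channel xyv => vy0.
have [pxy _] := channel_law_gt0 p_pmf w_channel xyv.
rewrite -[pVY p w v y]/(joint_out p w v y) (_ : _ / (_ * _) = lratio_cond p w v x y).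
  by field; have := ln2_gt0; lra.
by rewrite /lratio_cond; field; lra.
Qed.

Lemma cond_MI_ge0 (w : {set X} -> X -> R) : channel w -> 0 <= cond_MI p w.
Proof.
move=> w_channel; have := cond_info_ge0 p_pmf w_channel.
by rewrite -cond_MI_cond_info //; have := ln2_gt0; nra.
Qed.

Lemma admissible_channel (w : {set X} -> X -> R) : admissible_V p f w -> channel w.
Proof. by case=> w0 [w1 _]. Qed.

Lemma indep_set1 (x : X) : indep_set p f [set x].
Proof. by move=> x1 x2 /set1P -> /set1P -> [y []]. Qed.

Lemma singleton_admissible : admissible_V p f (fun v x => indic (v == [set x])).
Proof.
split; first by move=> v x; exact: indic_ge0.
split=> [x|v x]; first exact: rsum_indic_eq.
case: eqVneq => [->|_] /=; last lra.
by move=> _; split; [exact: indep_set1|rewrite inE].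
Qed.

Lemma cond_graph_entropy_glb :
  is_glb (fun r => exists w, admissible_V p f w /\ r = cond_MI p w) (cond_graph_entropy p f).
Proof.
apply: (@Rinf_glb _ 0); last first.
  by move=> r [w [/admissible_channel w_channel ->]]; exact: cond_MI_ge0.
pose w (v : {set X}) x := indic (v == [set x]).
by exists (cond_MI p w), w; split=> //; exact: singleton_admissible.
Qed.

Lemma cond_graph_entropy_le (w : {set X} -> X -> R) :
  admissible_V p f w -> cond_graph_entropy p f * ln 2 <= cond_info p w.
Proof.
move=> w_adm; rewrite -(cond_MI_cond_info (admissible_channel w_adm)).
apply: Rmult_le_compat_r; first exact: Rlt_le ln2_gt0.
by apply: (proj1 cond_graph_entropy_glb); exists w.
Qed.

Lemma cond_graph_entropy_lt (r : R) : cond_graph_entropy p f < r ->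
  exists2 w, admissible_V p f w & 0 <= cond_MI p w < r.
Proof.
move=> r_gt; apply: NNPP => no_w; have [_ /(_ r) glb] := cond_graph_entropy_glb.
suff : r <= cond_graph_entropy p f by lra.
apply: glb => _ [w [w_adm ->]]; apply: Rnot_lt_le => w_r; apply: no_w; exists w => //.
by split=> //; exact/cond_MI_ge0/admissible_channel.
Qed.

(* All the [x] in an independent set that are compatible with [y] give the same [f x y];
   [z0] is a junk value, used when there is none. *)
Definition graph_decode (z0 : F) (v : {set X}) (y : Y) : F :=
  if [pick x in v | Rltb 0 (p x y)] is Some x then f x y else z0.

Lemma graph_decodeE (z0 : F) (v : {set X}) (x : X) (y : Y) :
  indep_set p f v -> x \in v -> 0 < p x y -> graph_decode z0 v y = f x y.
Proof.
move=> v_indep xv pxy; rewrite /graph_decode; case: pickP => [x'|/(_ x)]; last first.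
  by rewrite /= xv; case: RltbP.
case/andP=> x'v /RltbP px'y; case: (eqVneq (f x' y) (f x y)) => // /eqP neq.
by case: (v_indep x' x x'v xv); exists y; split=> //; exact: Rmult_lt_0_compat.
Qed.

Lemma graph_decode_fseq (w : {set X} -> X -> R) (z0 : F) (n : nat)
    (xs : {ffun 'I_n -> X}) (ys : {ffun 'I_n -> Y}) (vs : {ffun 'I_n -> {set X}}) :
  admissible_V p f w -> 0 < Pn p xs ys -> 0 < iid_channel w n vs xs ->
  [ffun i => graph_decode z0 (vs i) (ys i)] = fseq f xs ys.
Proof.
move=> [w0 [_ w_indep]] xy0 vx0; apply/ffunP => i; rewrite !ffunE.
have pi := Pn_gt0_term p_pmf i xy0.
have wi : 0 < w (vs i) (xs i).
  by apply: (@rprod_gt0_term _ (fun i => w (vs i) (xs i))).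
have [v_indep xv] := w_indep _ _ (Rmult_lt_0_compat _ _ (pX_gt0 p_pmf pi) wi).
exact: graph_decodeE.
Qed.

Lemma achievable_above (R0 RY : R) :
  cond_graph_entropy p f < R0 -> entropy_f p f < RY -> achievable p f R0 0 RY.
Proof.
move=> /cond_graph_entropy_lt [w w_adm [w_ge0 w_lt]] RY_gt eps eps0.
have w_channel := admissible_channel w_adm.
have [||u u_cv0 describe] := @side_information_coding _ _ _ _ _ p_pmf w_channel R0.
- by lra.
- rewrite -cond_infoE // -cond_MI_cond_info //.
  exact: Rmult_lt_compat_r ln2_gt0 w_lt.
have [u' u'_cv0 compress] := function_coding p_pmf RY_gt.
have [N uN] := Un_cv0_eventually_le (Un_cv0D u_cv0 u'_cv0) eps0.
have [[x0 y0] _] := distr_supp (proj2 (distr_joint p_pmf)).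
exists N => n /uN u_eps.
have [enc [dec dec_err]] := describe n; have [e [d d_err]] := compress n.
exists enc, (fun=> Ordinal (msgs_gt0 n (Rle_refl 0))),
  (fun ys m => e [ffun i => graph_decode (f x0 y0) (dec m ys i) (ys i)]), (fun=> d).
rewrite err_probE; apply: Rle_trans u_eps.
apply: Rle_trans (Rplus_le_compat _ _ _ _ dec_err d_err).
have [joint0 _] := distr_joint (Pn_pmf p_pmf n).
rewrite /prob -expectD; apply: expect_le => // -[xs ys] xy0 /=.
case: RltbP => [vx0|_] /=.
  by rewrite (graph_decode_fseq _ w_adm xy0 vx0); lra.
rewrite -[X in X <= _]Rplus_0_r.
by apply: Rplus_le_compat (indic_ge0 _); exact: indic_le1.
Qed.

End GraphEntropy.

(** * Single-letter channels of a block code *)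

Section SetCoord.
Variables (J Y : finType).
Implicit Types (ys : {ffun J -> Y}).

Definition set_coord ys (i : J) (y : Y) : {ffun J -> Y} :=
  [ffun j => if j == i then y else ys j].

Lemma set_coord_same ys i y : set_coord ys i y i = y.
Proof. by rewrite ffunE eqxx. Qed.

Lemma set_coord_twice ys i y y' : set_coord (set_coord ys i y) i y' = set_coord ys i y'.
Proof. by apply/ffunP => j; rewrite !ffunE; case: (j == i). Qed.

Lemma set_coord_id ys i : set_coord ys i (ys i) = ys.
Proof. by apply/ffunP => j; rewrite !ffunE; case: eqP => // ->. Qed.

End SetCoord.

Section Resampling.
Variables (X Y : finType) (p : X -> Y -> R) (n : nat) (i : 'I_n).

Lemma Pn_set_coord (xs : {ffun 'I_n -> X}) (ys : {ffun 'I_n -> Y}) y :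
  Pn p xs (set_coord ys i y) * p (xs i) (ys i) = Pn p xs ys * p (xs i) y.
Proof.
rewrite /Pn (bigD1 i) //= [in RHS](bigD1 i) //= set_coord_same.
set others := (X in _ = _ * X * _).
rewrite [X in _ * X * _ = _](_ : _ = others); first by ring.
by apply: eq_bigr => j /negbTE ji; rewrite ffunE ji.
Qed.

(* Exchanging [Y_i] with a fresh copy is an involution that preserves the law. *)
Lemma rsum_resample (xs : {ffun 'I_n -> X}) (g : {ffun 'I_n -> Y} -> R) :
  \sum_ys Pn p xs ys * (\sum_y p (xs i) y * g (set_coord ys i y))
  = pX p (xs i) * \sum_ys Pn p xs ys * g ys.
Proof.
pose swap (u : {ffun 'I_n -> Y} * Y) := (set_coord u.1 i u.2, u.1 i).
have swapK : involutive swap.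
  by case=> ys y; rewrite /swap /= set_coord_twice set_coord_same set_coord_id.
transitivity (\sum_u Pn p xs u.1 * (p (xs i) u.2 * g (set_coord u.1 i u.2))).
  by rewrite rsum_pair; apply: eq_rsum => ys; rewrite rsum_distrr.
rewrite (rsum_reindex _ (inv_bij swapK)) rsum_pair rsum_distrr; apply: eq_rsum => ys.
rewrite /pX rsum_distrl; apply: eq_rsum => y /=.
by rewrite set_coord_twice set_coord_id -Rmult_assoc Pn_set_coord; ring.
Qed.

Lemma expect_Pn_coord (g : X * Y -> R) : is_pmf p ->
  expect (joint (nfold p n)) (fun z => g (z.1 i, z.2 i)) = expect (joint p) g.
Proof.
move=> p_pmf; rewrite -(expect_iid_coord (distr_joint p_pmf) i) -expect_Pn.
by apply: eq_expect => z; rewrite ffunE.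
Qed.

End Resampling.

Section CoordChannel.
Variables (X Y V : finType) (p : X -> Y -> R) (n : nat) (i : 'I_n).
Variables (aux : {ffun 'I_n -> X} -> {ffun 'I_n -> Y} -> V) (v0 : X -> V).
Hypothesis p_pmf : is_pmf p.

Definition coord_joint (v : V) (x : X) : R :=
  prob (joint (nfold p n)) (fun z => (z.1 i == x) && (aux z.1 z.2 == v)).

(* The conditional law of [aux X^n Y^n] given [X_i = x], or the point mass at [v0 x]
   if this event has probability 0. *)
Definition coord_channel (v : V) (x : X) : R :=
  if Rltb 0 (pX p x) then coord_joint v x / pX p x else indic (v == v0 x).

Lemma coord_channelK v x : 0 < pX p x -> pX p x * coord_channel v x = coord_joint v x.
Proof. by move=> x0; rewrite /coord_channel; case: RltbP => // _; field; lra. Qed.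

Let joint_ge0 := proj1 (distr_joint (Pn_pmf p_pmf n)).

Lemma channel_coord : channel coord_channel.
Proof.
split=> [v x|x]; rewrite /coord_channel; case: RltbP => x0.
- by apply: Rdiv_ge0; [exact: prob_ge0|exact: Rlt_le].
- exact: indic_ge0.
- rewrite /Rdiv -rsum_distrl -expect_rsum -(Rinv_r (pX p x)); last by lra.
  congr (_ * _); transitivity (expect (joint (nfold p n)) (fun z => indic (z.1 i == x))).
    apply: eq_expect => z; rewrite -[RHS]Rmult_1_r -(rsum_indic_eq (aux z.1 z.2)) rsum_distrr.
    by apply: eq_rsum => v; rewrite [v == _]eq_sym; case: (z.1 i == x) => /=; ring.
  rewrite (expect_Pn_coord i (fun u => indic (u.1 == x)) p_pmf) expect_joint.
  rewrite -[RHS](rsum_pick x); apply: eq_rsum => x'; rewrite /pX rsum_distrr.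
  by apply: eq_rsum => y; rewrite Rmult_comm.
- exact: rsum_indic_eq.
Qed.

Lemma coord_channel_supp v x : 0 < pX p x * coord_channel v x ->
  exists (xs : {ffun 'I_n -> X}) (ys : {ffun 'I_n -> Y}), xs i = x /\ aux xs ys = v.
Proof.
move=> xv0; have pX0 := proj1 (distr_pX p_pmf) x.
have [x0 _] := Rmult_gt0_inv pX0 (proj1 channel_coord v x) xv0; move: xv0.
rewrite coord_channelK //.
case/rsum_gt0_term => -[xs ys] /= xys0; exists xs, ys; move: xys0.
by case: eqP => [->|_]; case: eqP => [->|_] //=; lra.
Qed.

Hypothesis aux_resample : forall xs ys y, aux xs (set_coord ys i y) = aux xs ys.

Definition coord_triple (z : {ffun 'I_n -> X} * {ffun 'I_n -> Y}) : X * Y * V :=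
  (z.1 i, z.2 i, aux z.1 z.2).

Lemma channel_law_coord u :
  channel_law p coord_channel u
  = push coord_triple (joint (nfold p n)) u.
Proof.
move: u => [[x y] v]; rewrite /push rsum_pair.
have fiber (xs : {ffun 'I_n -> X}) :
    \sum_(ys : {ffun 'I_n -> Y}) indic ((xs i, ys i, aux xs ys) == (x, y, v)) * Pn p xs ys
    = indic (xs i == x) * \sum_ys Pn p xs ys * (indic (ys i == y) * indic (aux xs ys == v)).
  rewrite rsum_distrr; apply: eq_rsum => ys; rewrite !xpair_eqE.
  by do 3!case: eqP => _ /=; ring.
rewrite (eq_rsum fiber) /=; case: (proj1 (distr_pX p_pmf) x) => [x0|x0]; last first.
  have p0 y' : p x y' = 0.
    have := proj1 p_pmf x y'.
    by case=> // /(pX_gt0 p_pmf); rewrite -x0 => /Rlt_irrefl.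
  rewrite p0 Rmult_0_l rsum0 // => xs; case: eqP => [xs_i|_] /=; last by ring.
  rewrite rsum0 ?Rmult_0_r // => ys; rewrite /Pn (bigD1 i) //= xs_i p0; ring.
apply: (Rmult_eq_reg_l (pX p x)); last by lra.
rewrite (_ : pX p x * _ = p x y * coord_joint v x); last by rewrite -coord_channelK //; ring.
rewrite /coord_joint /prob expect_joint !rsum_distrr; apply: eq_rsum => xs /=.
case: eqP => [xs_i|_] /=; last by rewrite rsum0 => [|ys]; ring.
rewrite Rmult_1_l -{2}xs_i -rsum_resample rsum_distrr xs_i; apply: eq_rsum => ys.
rewrite [RHS](_ : _ = Pn p xs ys * (p x y * indic (aux xs ys == v))); last first.
  congr (_ * _); rewrite -(rsum_pick y (fun y' => p x y' * indic (aux xs ys == v))).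
  by apply: eq_rsum => y'; rewrite set_coord_same aux_resample; ring.
by ring.
Qed.

End CoordChannel.

(** * Converse for the rate of the description of [X] *)

Lemma rsum2_rprod (J S T : finType) (g : J -> S -> T -> R) :
  \sum_(ss : {ffun J -> S}) \sum_(ts : {ffun J -> T}) \prod_j g j (ss j) (ts j)
  = \prod_j \sum_s \sum_t g j s t.
Proof.
under [RHS]eq_rprod => j do rewrite -(rsum_pair (fun u => g j u.1 u.2)).
rewrite -rsum_rprod rsum_zip_ffun; apply: eq_rsum => ss; apply: eq_rsum => ts.
by apply: eq_rprod => j; rewrite ffunE.
Qed.

(* Each pair of a message and a word [y] names a subdistribution on the words [(v, x)],
   hence the bound by the number of messages. *)
Lemma rsum_guess_le_card (J X Y V Msg : finType) (q : Y -> R)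
    (r : J -> V -> X -> Y -> R) (guess : J -> Msg -> {ffun J -> Y} -> V -> R)
    (m : {ffun J -> X} -> Msg) (aux : J -> {ffun J -> X} -> {ffun J -> Y} -> V) :
  distr q ->
  (forall j v x y, 0 <= r j v x y) -> (forall j v y, \sum_x r j v x y <= 1) ->
  (forall j k ys v, 0 <= guess j k ys v) -> (forall j k ys, \sum_v guess j k ys v <= 1) ->
  \sum_(xs : {ffun J -> X}) \sum_(ys : {ffun J -> Y}) \prod_j (q (ys j) *
    (r j (aux j xs ys) (xs j) (ys j) * guess j (m xs) ys (aux j xs ys))) <= INR #|Msg|.
Proof.
move=> q_distr r0 r1 guess0 guess1; have [q0 _] := q_distr.
pose weight k (xs : {ffun J -> X}) (ys : {ffun J -> Y}) (vs : {ffun J -> V}) :=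
  \prod_j (q (ys j) * (r j (vs j) (xs j) (ys j) * guess j k ys (vs j))).
have weight0 k xs ys vs : 0 <= weight k xs ys vs.
  by apply: rprod_ge0 => j; do 2?apply: Rmult_le_pos.
apply: Rle_trans (_ : \sum_k \sum_ys \sum_xs \sum_vs weight k xs ys vs <= _).
  rewrite [X in X <= _]exchange_rsum [X in _ <= X]exchange_rsum; apply: rsum_le => ys.
  rewrite [X in _ <= X]exchange_rsum; apply: rsum_le => xs.
  apply: Rle_trans (le_rsum_term (m xs) (fun k => rsum_ge0 (weight0 k xs ys))).
  apply: Rle_trans (le_rsum_term [ffun j => aux j xs ys] (weight0 (m xs) xs ys)).
  by apply: Req_le; apply: eq_rprod => j; rewrite ffunE.
rewrite -[X in _ <= X]Rmult_1_r -rsum_const; apply: rsum_le => k.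
rewrite -(proj2 (distr_iid J q_distr)); apply: rsum_le => ys.
rewrite (rsum2_rprod (fun j x v => q (ys j) * (r j v x (ys j) * guess j k ys v))).
apply: rprod_le => j; split.
  by apply: rsum_ge0 => x; apply: rsum_ge0 => v; do 2?apply: Rmult_le_pos.
rewrite exchange_rsum -[X in _ <= X]Rmult_1_r.
apply: Rle_trans (Rmult_le_compat_l _ _ _ (q0 (ys j)) (guess1 j k ys)).
rewrite rsum_distrr; apply: rsum_le => v; rewrite -rsum_distrr -rsum_distrl.
apply: Rmult_le_compat_l => //; rewrite -[X in _ <= X]Rmult_1_l.
exact: Rmult_le_compat_r.
Qed.

Section MessageBound.
Variables (X Y V Msg : finType) (p : X -> Y -> R) (v0 : X -> V) (n : nat).
Variable m : {ffun 'I_n -> X} -> Msg.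
Variable aux : 'I_n -> {ffun 'I_n -> X} -> {ffun 'I_n -> Y} -> V.
Variable guess : 'I_n -> Msg -> {ffun 'I_n -> Y} -> V -> R.
Hypothesis p_pmf : is_pmf p.
Hypothesis aux_resample : forall i xs ys y, aux i xs (set_coord ys i y) = aux i xs ys.
Hypothesis guess_gt0 : forall i k ys v, 0 < guess i k ys v.
Hypothesis guess_le1 : forall i k ys, \sum_v guess i k ys v <= 1.

Let w i := coord_channel p i (aux i) v0.

Lemma message_bound :
  \sum_i cond_info p (w i) +
  \sum_i expect (joint (nfold p n)) (fun z => ln (guess i (m z.1) z.2 (aux i z.1 z.2)))
    <= ln (INR #|Msg|).
Proof.
have w_channel i : channel (w i) by exact: channel_coord.
have [joint0 joint1] := distr_joint (Pn_pmf p_pmf n).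
pose factor i (z : {ffun 'I_n -> X} * {ffun 'I_n -> Y}) :=
  lratio_cond p (w i) (aux i z.1 z.2) (z.1 i) (z.2 i) * guess i (m z.1) z.2 (aux i z.1 z.2).
have ratio_gt0 i z : 0 < joint (nfold p n) z ->
    0 < lratio_cond p (w i) (aux i z.1 z.2) (z.1 i) (z.2 i).
  move=> z0; apply: (lratio_cond_gt0 p_pmf (w_channel i)).
  rewrite channel_law_coord //.
  exact: (push_gt0 (coord_triple i (aux i)) joint0 z0).
have factor_gt0 i z : 0 < joint (nfold p n) z -> 0 < factor i z.
  by move=> z0; apply: Rmult_lt_0_compat (ratio_gt0 i z z0) (guess_gt0 _ _ _ _).
have cond_info_aux i : cond_info p (w i) = expect (joint (nfold p n))
    (fun z => ln (lratio_cond p (w i) (aux i z.1 z.2) (z.1 i) (z.2 i))).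
  rewrite -(expect_push (coord_triple i (aux i)) _
    (fun '(x, y, v) => ln (lratio_cond p (w i) v x y))).
  by apply: eq_rsum => u; rewrite channel_law_coord.
rewrite (eq_rsum cond_info_aux) -rsumD.
under eq_rsum => i do rewrite -expectD.
rewrite -expect_rsum.
rewrite (@eq_expect_supp _ _ joint0 _ (fun z => ln (\prod_i factor i z))); last first.
  move=> z z0; rewrite ln_rprod => [|i]; last exact: factor_gt0.
  by apply: eq_rsum => i; rewrite /factor ln_mult //; exact: ratio_gt0 i z z0.
have [[xs0 _] _] := distr_supp joint1.
have msg_gt0 : 0 < INR #|Msg| by apply/lt_0_INR/ltP/card_gt0P; exists (m xs0).
apply: expect_ln_le => // [z z0|]; first by apply: rprod_gt0 => i; exact: factor_gt0.
pose r i v x y := p x y * w i v x / joint_out p (w i) v y.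
apply: Rle_trans
  (rsum_guess_le_card (r := r) (guess := guess) m aux (distr_pY p_pmf) _ _ _ guess_le1).
- rewrite expect_joint; apply: Req_le; apply: eq_rsum => xs; apply: eq_rsum => ys.
  rewrite -rprodM; apply: eq_rprod => i; rewrite /factor /r /lratio_cond /Rdiv /=; ring.
- move=> i v x y; apply: Rdiv_ge0; last exact: joint_out_ge0.
  exact: Rmult_le_pos (proj1 p_pmf x y) (proj1 (w_channel i) v x).
- by move=> i v y; rewrite /r /Rdiv -rsum_distrl; exact: Rdiv_self_le1.
- by move=> *; exact: Rlt_le.
Qed.

End MessageBound.

(* The uniform part keeps the logarithm bounded below when [t != t0]. *)
Definition smoothed (T : finType) (d : R) (t0 t : T) : R :=
  (1 - d) * indic (t == t0) + d / INR #|T|.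

Section Smoothed.
Variables (T : finType) (d : R) (t0 : T).
Hypothesis d01 : 0 < d < 1.

Lemma uniform_weight_bounds : 0 < d / INR #|T| < 1.
Proof.
have T1 := (INR_card_ge1 t0); split; first by apply: Rdiv_lt_0_compat; lra.
apply: (Rmult_lt_reg_r (INR #|T|)); first by lra.
by rewrite /Rdiv Rmult_assoc Rinv_l; lra.
Qed.

Lemma smoothed_gt0 (t : T) : 0 < smoothed d t0 t.
Proof.
have [u0 _] := uniform_weight_bounds; have := indic_ge0 (t == t0).
by rewrite /smoothed; nra.
Qed.

Lemma rsum_smoothed : \sum_t smoothed d t0 t = 1.
Proof.
rewrite /smoothed rsumD -rsum_distrr rsum_indic_eq rsum_const.
by field; have := (INR_card_ge1 t0); lra.
Qed.

Lemma ln_smoothed_ge (t : T) :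
  ln (1 - d) + indic (t != t0) * ln (d / INR #|T|) <= ln (smoothed d t0 t).
Proof.
have := uniform_weight_bounds; rewrite /smoothed; set u := d / _ => -[u0 u1].
have d_lt0 : ln (1 - d) < 0 by apply: ln_lt0; lra.
case: eqVneq => _ /=.
- by rewrite Rmult_0_l Rplus_0_r Rmult_1_r; apply: ln_le; lra.
- by rewrite Rmult_1_l Rmult_0_r Rplus_0_l; lra.
Qed.

End Smoothed.

Lemma pos_values_bounded_below (T : finType) (g : T -> R) :
  exists2 c, 0 < c & forall t, 0 < g t -> c <= g t.
Proof.
pose inv t := indic (Rltb 0 (g t)) * / g t.
have inv0 t : 0 <= inv t.
  rewrite /inv; case: RltbP => [gt0|_] /=; last by lra.
  by rewrite Rmult_1_l; exact/Rlt_le/Rinv_0_lt_compat.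
have sum0 := rsum_ge0 inv0.
exists (/ (1 + \sum_t inv t)) => [|t gt0]; first by apply: Rinv_0_lt_compat; lra.
rewrite -[g t]Rinv_inv; apply: Rinv_le_contravar; first exact: Rinv_0_lt_compat.
have := le_rsum_term t inv0; rewrite {1}/inv; case: RltbP => //= _; lra.
Qed.

Section DecodableSets.
Variables (X Y F Msg : finType) (p : X -> Y -> R) (f : X -> Y -> F) (n : nat).
Variables (m : {ffun 'I_n -> X} -> Msg) (g : Msg -> {ffun 'I_n -> Y} -> {ffun 'I_n -> F}).
Hypothesis p_pmf : is_pmf p.

Definition decodable_set (i : 'I_n) (k : Msg) (ys : {ffun 'I_n -> Y}) : {set X} :=
  [set x | [forall y, Rltb 0 (p x y) ==> (g k (set_coord ys i y) i == f x y)]].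

Definition decodable_or_singleton (i : 'I_n) (xs : {ffun 'I_n -> X}) (ys : {ffun 'I_n -> Y}) :
    {set X} :=
  if xs i \in decodable_set i (m xs) ys then decodable_set i (m xs) ys else [set xs i].

Lemma decodable_set_resample i k ys y :
  decodable_set i k (set_coord ys i y) = decodable_set i k ys.
Proof.
by apply/setP => x; rewrite !inE; apply: eq_forallb => y'; rewrite set_coord_twice.
Qed.

Lemma decodable_set_indep i k ys : indep_set p f (decodable_set i k ys).
Proof.
move=> x1 x2; rewrite !inE => /forallP dec1 /forallP dec2 [y [pp]]; case.
have [/RltbP p1 /RltbP p2] := Rmult_gt0_inv (proj1 p_pmf x1 y) (proj1 p_pmf x2 y) pp.
by rewrite -(eqP (implyP (dec1 y) p1)) -(eqP (implyP (dec2 y) p2)).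
Qed.

Lemma coord_channel_admissible i :
  admissible_V p f (coord_channel p i (decodable_or_singleton i) set1).
Proof.
have [w0 w1] := channel_coord i (decodable_or_singleton i) set1 p_pmf.
split=> //; split=> // v x /(coord_channel_supp p_pmf) [xs [ys [<- <-]]].
rewrite /decodable_or_singleton; case: ifP => [x_dec|_].
  by split=> //; exact: decodable_set_indep.
by split; [exact: indep_set1|rewrite inE].
Qed.

Lemma undecodable_prob_le i (c : R) :
  (forall x y, 0 < p x y -> c <= p x y) ->
  c * prob (joint (nfold p n)) (fun z => z.1 i \notin decodable_set i (m z.1) z.2)
    <= prob (joint (nfold p n)) (fun z => g (m z.1) z.2 != fseq f z.1 z.2).
Proof.
move=> p_ge_c; have [p0 _] := p_pmf; have Pn0 := proj1 (Pn_pmf p_pmf n).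
rewrite /prob !expect_joint rsum_distrr; apply: rsum_le => xs /=.
pose wrong ys := indic (g (m xs) ys i != f (xs i) (ys i)).
have wrong0 ys : 0 <= wrong ys by exact: indic_ge0.
apply: Rle_trans (_ : pX p (xs i) * (\sum_ys Pn p xs ys * wrong ys) <= _).
  rewrite -rsum_resample rsum_distrr; apply: rsum_le => ys.
  have term0 y : 0 <= p (xs i) y * wrong (set_coord ys i y) by apply: Rmult_le_pos.
  rewrite -Rmult_assoc [c * _]Rmult_comm Rmult_assoc; apply: Rmult_le_compat_l => //.
  case: (boolP (xs i \in _)) => [_|] /=; first by rewrite Rmult_0_r; exact: rsum_ge0.
  rewrite inE Rmult_1_r => /forallPn [y]; rewrite negb_imply => /andP [/RltbP py neq].
  apply: Rle_trans (p_ge_c _ _ py) _; apply: Rle_trans (le_rsum_term y term0).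
  by rewrite /wrong set_coord_same neq /=; lra.
rewrite -[X in _ <= X]Rmult_1_l; apply: Rmult_le_compat.
- exact: (proj1 (distr_pX p_pmf)).
- by apply: rsum_ge0 => ys; apply: Rmult_le_pos.
- by have [pX0 pX1] := distr_pX p_pmf; exact: distr_le1.
apply: rsum_le => ys; apply: Rmult_le_compat_l => //; rewrite /wrong.
case: (eqVneq (g (m xs) ys)) => [->|_]; first by rewrite ffunE eqxx; exact: Rle_refl.
exact: indic_le1.
Qed.

Lemma single_letter_converse (c d eps : R) :
  0 < c -> (forall x y, 0 < p x y -> c <= p x y) -> 0 < d < 1 ->
  prob (joint (nfold p n)) (fun z => g (m z.1) z.2 != fseq f z.1 z.2) <= eps ->
  INR n * (cond_graph_entropy p f * ln 2 + ln (1 - d) + eps / c * ln (d / INR #|{set X}|))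
    <= ln (INR #|Msg|).
Proof.
move=> c0 p_ge_c d01 err_le; have [joint0 joint1] := distr_joint (Pn_pmf p_pmf n).
pose guess i k ys := smoothed d (decodable_set i k ys).
have aux_resample i xs ys y :
    decodable_or_singleton i xs (set_coord ys i y) = decodable_or_singleton i xs ys.
  by rewrite /decodable_or_singleton decodable_set_resample.
apply: Rle_trans (message_bound set1 m p_pmf aux_resample (guess := guess) _ _); first last.
- by move=> i k ys; rewrite rsum_smoothed; exact: Rle_refl.
- by move=> i k ys v; exact: smoothed_gt0.
rewrite -{1}(card_ord n) -rsum_const -rsumD; apply: rsum_le => i.
rewrite Rplus_assoc; apply: Rplus_le_compat.
  exact: cond_graph_entropy_le (coord_channel_admissible i).
set L := ln (d / _); pose missed := prob (joint (nfold p n))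
  (fun z => z.1 i \notin decodable_set i (m z.1) z.2).
apply: Rle_trans (_ : ln (1 - d) + missed * L <= _).
  have L0 : L < 0 by apply: ln_lt0; exact: uniform_weight_bounds set0 d01.
  suff : missed <= eps / c by nra.
  apply: (Rmult_le_reg_l c) => //; apply: Rle_trans (undecodable_prob_le i p_ge_c) _.
  by apply: Rle_trans err_le _; apply: Req_le; field; lra.
rewrite Rmult_comm /missed /prob -expectZ -{1}(expect_cst joint1 (ln (1 - d))) -expectD.
apply: expect_le => // z _; apply: Rle_trans (ln_smoothed_ge _ d01 _).
rewrite -/L [L * _]Rmult_comm; apply: Req_le; congr (_ + indic _ * _).
rewrite /decodable_or_singleton; case: ifP => [|z_dec]; first by rewrite eqxx.
by apply/esym/eqP => eq_dec; move: z_dec; rewrite -eq_dec set11.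
Qed.

End DecodableSets.

Lemma ln_msgs_le (n : nat) (a b : R) : (0 < msgs n a * msgs n b)%nat ->
  ln (INR #|{: 'I_(msgs n a) * 'I_(msgs n b)}|) <= INR n * ((a + b) * ln 2).
Proof.
move=> msgs0; rewrite card_prod !card_ord -[X in _ <= X]ln_exp.
by apply: ln_le (msgs_mul_le n a b); exact/lt_0_INR/ltP.
Qed.

Lemma description_rate_converse (X Y F : finType) (p : X -> Y -> R) (f : X -> Y -> F)
    (a b c : R) :
  is_pmf p -> achievable p f a b c -> cond_graph_entropy p f <= a + b.
Proof.
move=> p_pmf ach; apply: (Rmult_le_reg_r (ln 2) _ _ ln2_gt0); apply: le_epsilon => eta eta0.
have [c0 c0_gt0 c0_le] := pos_values_bounded_below (joint p).
pose d := 1 - exp (- (eta / 2)); pose L := ln (d / INR #|{set X}|).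
have d01 : 0 < d < 1.
  have := exp_pos (- (eta / 2)); have := @exp_lt1 (- (eta / 2)).
  by rewrite /d; lra.
have ln_d : ln (1 - d) = - (eta / 2).
  by rewrite -[RHS]ln_exp; congr ln; rewrite /d; ring.
have L0 : 0 < 1 + Rabs L by have := Rabs_pos L; lra.
pose q := eta / 2 / (1 + Rabs L).
have q0 : 0 < q by apply: Rdiv_lt_0_compat; lra.
have qL : - (eta / 2) <= q * L.
  have -> : - (eta / 2) = q * - (1 + Rabs L) by rewrite /q; field; lra.
  by apply: Rmult_le_compat_l; [lra|have := Rle_abs (- L); rewrite Rabs_Ropp; lra].
have [N code] := ach (c0 * q) (Rmult_lt_0_compat _ _ c0_gt0 q0).
have [phi0 [phiX [phiY [psi]]]] := code N.+1 (leqnSn N).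
rewrite err_probE => err_le.
have [[xs0 _] _] := distr_supp (proj2 (distr_joint (Pn_pmf p_pmf N.+1))).
have n0 : 0 < INR N.+1 by apply: lt_0_INR; exact/ltP.
have := @single_letter_converse _ _ _ _ p f _ (fun xs => (phi0 xs, phiX xs))
  (fun k ys => psi k.2 (phiY ys k.1)) p_pmf c0 d (c0 * q) c0_gt0 (fun x y => c0_le (x, y)) d01
  err_le.
rewrite -/L ln_d (_ : c0 * q / c0 = q); last by field; lra.
move=> /Rle_trans /(_ (ln_msgs_le _)) bound.
have msgs0 : (0 < msgs N.+1 a * msgs N.+1 b)%nat.
  by rewrite muln_gt0 (leq_ltn_trans _ (ltn_ord (phi0 xs0)))
     ?(leq_ltn_trans _ (ltn_ord (phiX xs0))).
have := Rmult_le_reg_l _ _ _ n0 (bound msgs0); lra.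
Qed.

Theorem theorem6 (X Y F : finType) (p : X -> Y -> R) (f : X -> Y -> F)
  (hp : is_pmf p) (R0 RY : R) :
  in_rate_region p f R0 0 RY <->
  (cond_graph_entropy p f <= R0 /\ entropy_f p f <= RY)%R.
Proof.
split=> [in_region|[R0_ge RY_ge] d d0].
- split; apply: le_epsilon => eps eps0.
  + have [|a [b [c [ach [/Rabs_def2 a_R0 [/Rabs_def2 b_0 _]]]]]] := in_region (eps / 2).
      by lra.
    by have := description_rate_converse hp ach; lra.
  + have [|a [b [c [ach [_ [/Rabs_def2 b_0 /Rabs_def2 c_RY]]]]]] := in_region (eps / 2).
      by lra.
    by have := function_rate_converse hp ach; lra.
- exists (R0 + d / 2), 0, (RY + d / 2); split; first by apply: achievable_above => //; lra.
  by split; [|split]; apply: Rabs_def1; lra.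
Qed.
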